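(* Suppose that the communication graph $\mathcal{G}$ is strongly connected and that the payoff functions $f_1,\dots,f_N$ satisfy (A2), (A3), (A4) of the context, and that the players' actions and estimates are governed by the system (S) of the context. Then there exists a scalar $\epsilon\in(0,\epsilon^* )$ such that (S) has the exponentially stable equilibrium point $(\mathbf{x}^*,\mathbf{1}_N\otimes\mathbf{x}^* )$ under aperiodically intermittent communication with average communication ratio $\vartheta\in(0,1)$ satisfying $$\vartheta>\frac{\mu_2}{\mu_1+\mu_2}.$$
   Context: **Graph.** $\mathcal{G}=(\mathcal{N},\mathcal{E})$ is a directed graph on $\mathcal{N}=\{1,\dots,N\}$ without self-loops, with weighted adjacency matrix $\mathcal{A}=(a_{ij})$, where $a_{ij}>0$ if $(j,i)\in\mathcal{E}$ and $a_{ij}=0$ otherwise ($a_{ii}=0$). The Laplacian is $\mathcal{L}=\mathcal{D}-\mathcal{A}$, $\mathcal{D}=\mathrm{diag}\{d_1^{in},\dots,d_N^{in}\}$, $d_i^{in}=\sum_{j}a_{ij}$. Strongly connected: every node has a directed path to every other node. Let $\mathcal{B}=\mathrm{diag}\{a_{ij}\}$ be the $N^2\times N^2$ diagonal matrix with entries $a_{11},a_{12},\dots,a_{1N},a_{21},\dots,a_{NN}$. For $\mathcal{G}$ strongly connected it is known that there are positive definite $N^2\times N^2$ matrices $P$ (diagonal) and $Q$ with $(\mathcal{L}\otimes I_N+\mathcal{B})^{\top}P+P(\mathcal{L}\otimes I_N+\mathcal{B})=Q$; fix such $P,Q$. **Game.** Player $i$ has action $x_i\in\mathbb{R}$ and payoff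 $f_i(\mathbf{x})$, $\mathbf{x}=(x_1,\dots,x_N)^\top\in\mathbb{R}^N$, to be maximized over $x_i$. A Nash equilibrium is $\mathbf{x}^*=(x_i^*,\mathbf{x}_{-i}^* )$ with $f_i(x_i,\mathbf{x}^*_{-i})\le f_i(x_i^*,\mathbf{x}_{-i}^* )$ for all $x_i\in\mathbb{R}$, $i\in\mathcal{N}$, where $\mathbf{x}_{-i}$ collects the actions of the players other than $i$. Put $\frac{\partial G}{\partial\mathbf{x}}(\mathbf{x})=\big(\frac{\partial f_1}{\partial x_1}(\mathbf{x}),\dots,\frac{\partial f_N}{\partial x_N}(\mathbf{x})\big)^\top$. Assumptions: - (A2) each $f_i$ is twice continuously differentiable; - (A3) there is $\alpha>0$ with $\big|\frac{\partial f_i}{\partial x_i}(\mathbf{x})-\frac{\partial f_i}{\partial x_i}(\mathbf{z})\big|\le\alpha|\mathbf{x}-\mathbf{z}|$ for all $i$ and $\mathbf{x},\mathbf{z}\in\mathbb{R}^N$; - (A4) each $f_i$ is concave in $x_i$, and there is $\beta>0$ with $(\mathbf{x}-\mathbf{z})^\top\big(\frac{\partial G}{\partial\mathbf{x}}(\mathbf{x})-\frac{\partial G}{\partial\mathbf{x}}(\mathbf{z})\big)\le-\beta|\mathbf{x}-\mathbf{z}|^2$ for all $\mathbf{x},\mathbf{z}\in\mathbb{R}^N$. These guarantee a unique Nash equilibrium $\mathbf{x}^*$, and $\frac{\partial G}{\partial\mathbf{x}}(\mathbf{x})=\mathbf{0}$ iff $\mathbf{x}=\mathbf{x}^*$. **System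 (S).** Let $0=t_0<s_0<t_1<s_1<\cdots$ with $t_m\to\infty$; $[t_m,s_m)$ is the $m$-th communication time and $[s_m,t_{m+1})$ the $m$-th silent time. Let $\bar k_i>0$ be constants and $\epsilon>0$. Player $i$ holds $\mathbf{y}_i=(y_{i1},\dots,y_{iN})^\top\in\mathbb{R}^N$ (its estimates of all actions), $\mathbf{y}=(\mathbf{y}_1^\top,\dots,\mathbf{y}_N^\top)^\top\in\mathbb{R}^{N^2}$. For all $i,j\in\mathcal{N}$: $$\dot x_i(t)=\epsilon\bar k_i\,\frac{\partial f_i}{\partial x_i}(\mathbf{y}_i(t)),$$ $$\dot y_{ij}(t)=-\Big(\sum_{k=1}^N a_{ik}(y_{ij}-y_{kj})+a_{ij}(y_{ij}-x_j)\Big)\ \text{for } t\in[t_m,s_m),\qquad \dot y_{ij}(t)=0\ \text{for } t\in[s_m,t_{m+1}).$$ **Average communication ratio (ACR).** For $0\le s<t<\infty$ let $\mathcal{M}(t,s)$ be the total length of communication time in $[s,t)$ and $\mathcal{M}^{\mathrm c}(t,s)=t-s-\mathcal{M}(t,s)$ the total length of silent time in $[s,t)$. The aperiodically intermittent communication admits an ACR $\vartheta$ if $\vartheta\in(0,1)$ is a constant such that, for $0\le s<t<\infty$, $$\mathcal{M}(t,s)\ge\vartheta(t-s),\qquad \mathcal{M}^{\mathrm c}(t,s)=t-s-\mathcal{M}(t,s)\le(1-\vartheta)(t-s).$$ **Constants.** It is known that under (A2)–(A4) there are positive constants $\gamma_1,\dots,\gamma_5$ and a (differentiable) real function $\bar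 V$ defined for $|\mathbf{e}|\le\gamma_5$, where $\mathbf{e}=\mathbf{x}-\mathbf{x}^*$, such that $\gamma_1|\mathbf{e}|^2\le\bar V(\mathbf{e})\le\gamma_2|\mathbf{e}|^2$, $\ \big(\frac{\partial\bar V}{\partial\mathbf{e}}\big)^\top\mathrm{diag}\{\bar k_i\}\frac{\partial G}{\partial\mathbf{x}}(\mathbf{x})\le-\gamma_3|\mathbf{e}|^2$, $\ \big|\frac{\partial\bar V}{\partial\mathbf{e}}\big|\le\gamma_4|\mathbf{e}|$. Fix these. Let $\Vert P\Vert$ be the induced norm and $\lambda_{\min},\lambda_{\max}$ the extreme eigenvalues. Put $$\pi_1=\alpha\max_i\{\bar k_i\}\big(\tfrac{\gamma_4}{2}+N\Vert P\Vert\big),\quad \pi_2=2\alpha\sqrt N\,\Vert P\Vert\max_i\{\bar k_i\},$$ $$\epsilon_1^*=\frac{\gamma_3\lambda_{\min}(Q)}{\gamma_3\pi_2+\pi_1^2},\quad \epsilon_2^*=\frac{\gamma_3^2\pi_2^2}{\pi_1^4},\quad \epsilon^*=\min\{\epsilon_1^*,\epsilon_2^*\},$$ $$\Gamma_1=\begin{pmatrix}\epsilon\gamma_3&-\epsilon\pi_1\\-\epsilon\pi_1&\lambda_{\min}(Q)-\epsilon\pi_2\end{pmatrix},\quad \Gamma_2=\begin{pmatrix}\sqrt\epsilon\,\gamma_3&\epsilon\pi_1\\ \epsilon\pi_1&\epsilon\pi_2\end{pmatrix}.$$ With $\mathbf{e}_{\mathbf{x}}=\mathbf{y}-\mathbf{1}_N\otimes\mathbf{x}$,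 let $V(\mathbf{e},\mathbf{e}_{\mathbf{x}})=\bar V(\mathbf{e})+\mathbf{e}_{\mathbf{x}}^\top P\mathbf{e}_{\mathbf{x}}$, and let $\eta_1,\eta_2>0$ be fixed constants with $\eta_1(|\mathbf{e}|^2+|\mathbf{e}_{\mathbf{x}}|^2)\le V\le\eta_2(|\mathbf{e}|^2+|\mathbf{e}_{\mathbf{x}}|^2)$. Set $\mu_1=\lambda_{\min}(\Gamma_1)/\eta_2$ and $\mu_2=\lambda_{\max}(\Gamma_2)/\eta_1$ (both depend on $\epsilon$). **Exponential stability** of an equilibrium $z^*$ of (S) is meant in the usual sense: there are $\delta,c,\lambda>0$ such that every solution $z(t)=(\mathbf{x}(t),\mathbf{y}(t))$ starting at $t=0$ with $|z(0)-z^*|<\delta$ satisfies $|z(t)-z^*|\le c|z(0)-z^*|e^{-\lambda t}$ for all $t\ge0$.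
   Formalization: The ACR inequalities as given fail on any interval inside a silent time (there M = 0), so a constant T₀ ≥ 0 is allowed: M(t,s) ≥ ϑ(t−s) − T₀ and Mᶜ(t,s) ≤ (1−ϑ)(t−s) + T₀; the result is stated for every T₀ ≥ 0, with T₀ = 0 the original definition. *)

(* Defs.v *)
From HB Require Import structures.
From mathcomp Require Import all_boot all_order all_algebra.
From mathcomp Require Import mxtens.
From mathcomp Require Import all_classical all_reals all_analysis.

Set Implicit Arguments.
Unset Strict Implicit.
Unset Printing Implicit Defensive.

Import Order.TTheory GRing.Theory Num.Theory.
Import numFieldNormedType.Exports.

Local Open Scope classical_set_scope.
Local Open Scope ring_scope.

(* The library norm `|v| of a matrix is the sup norm, hence a separate
   Euclidean norm. *)
Definition enorm (R : realType) (n : nat) (v : 'cV[R]_n) : R :=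
  Num.sqrt (\sum_i v i 0 ^+ 2).

Definition dotv (R : realType) (n : nat) (u v : 'cV[R]_n) : R :=
  (u^T *m v) 0 0.

Definition posdefmx (R : realType) (n : nat) (A : 'M[R]_n) : Prop :=
  A^T = A /\ forall v : 'cV[R]_n, v != 0 -> 0 < dotv v (A *m v).

Definition opnorm (R : realType) (n : nat) (A : 'M[R]_n) : R :=
  sup [set enorm (A *m v) | v in [set v : 'cV[R]_n | enorm v <= 1]].

(* Only used for symmetric matrices of positive size, whose set of real
   eigenvalues is finite and nonempty, so that inf and sup are attained. *)
Definition lambda_min (R : realType) (n : nat) (A : 'M[R]_n) : R :=
  inf [set a : R | eigenvalue A a].

Definition lambda_max (R : realType) (n : nat) (A : 'M[R]_n) : R :=
  sup [set a : R | eigenvalue A a].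

Definition mx22 (R : realType) (a b c d : R) : 'M[R]_2 :=
  \matrix_(i < 2, j < 2)
    (if i == 0 then (if j == 0 then a else b)
     else (if j == 0 then c else d)).

(* E j i is the edge (j, i), from j to i. *)
Definition weighted_adjacency (R : realType) (N : nat) (E : rel 'I_N)
    (A : 'M[R]_N) : Prop :=
  forall i j, (E j i -> 0 < A i j) /\ (~~ E j i -> A i j = 0).

Definition strongly_connected (N : nat) (E : rel 'I_N) : Prop :=
  forall i j, connect E i j.

Definition laplacian (R : realType) (N : nat) (A : 'M[R]_N) : 'M[R]_N :=
  diag_mx (\row_i \sum_j A i j) - A.

(* R^(N^2) is 'cV_(N * N); the coordinate (i, j) sits at mxtens_index (i, j),
   i.e. at i * N + j, the ordering also used by the Kronecker product *t. *)
Definition ecoord (R : realType) (N : nat) (y : 'cV[R]_(N * N)) (i j : 'I_N) : R :=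
  y (mxtens_index (i, j)) 0.

Definition estimate (R : realType) (N : nat) (y : 'cV[R]_(N * N)) (i : 'I_N) :
    'cV[R]_N :=
  \col_j ecoord y i j.

(* 1_N (x) x *)
Definition ones_tens (R : realType) (N : nat) (x : 'cV[R]_N) : 'cV[R]_(N * N) :=
  \col_p x (mxtens_unindex p).2 0.

Definition Bmx (R : realType) (N : nat) (A : 'M[R]_N) : 'M[R]_(N * N) :=
  diag_mx (\row_p A (mxtens_unindex p).1 (mxtens_unindex p).2).

Definition LBmx (R : realType) (N : nat) (A : 'M[R]_N) : 'M[R]_(N * N) :=
  (laplacian A *t (1%:M : 'M[R]_N)) + Bmx A.

Definition partial (R : realType) (N : nat) (i : 'I_N) (g : 'cV[R]_N -> R) :
    'cV[R]_N -> R :=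
  fun x => 'D_(delta_mx i 0 : 'cV[R]_N) g x.

Definition grad (R : realType) (N : nat) (g : 'cV[R]_N -> R) (x : 'cV[R]_N) :
    'cV[R]_N :=
  \col_i partial i g x.

Definition C1 (R : realType) (N : nat) (g : 'cV[R]_N -> R) : Prop :=
  forall i : 'I_N,
    (forall x, derivable g x (delta_mx i 0 : 'cV[R]_N)) /\
    continuous (partial i g).

Definition C2 (R : realType) (N : nat) (g : 'cV[R]_N -> R) : Prop :=
  C1 g /\ forall i : 'I_N, C1 (partial i g).

(* (a, x_{-i}) *)
Definition upd (R : realType) (N : nat) (x : 'cV[R]_N) (i : 'I_N) (a : R) :
    'cV[R]_N :=
  \col_j (if j == i then a else x j 0).

Definition is_nash (R : realType) (N : nat) (f : 'I_N -> 'cV[R]_N -> R)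
    (xs : 'cV[R]_N) : Prop :=
  forall (i : 'I_N) (a : R), f i (upd xs i a) <= f i xs.

Definition pseudograd (R : realType) (N : nat) (f : 'I_N -> 'cV[R]_N -> R)
    (x : 'cV[R]_N) : 'cV[R]_N :=
  \col_i partial i (f i) x.

Definition lipschitz_partials (R : realType) (N : nat)
    (f : 'I_N -> 'cV[R]_N -> R) (alpha : R) : Prop :=
  forall (i : 'I_N) (x z : 'cV[R]_N),
    `|partial i (f i) x - partial i (f i) z| <= alpha * enorm (x - z).

Definition concave_own (R : realType) (N : nat)
    (f : 'I_N -> 'cV[R]_N -> R) : Prop :=
  forall (i : 'I_N) (x : 'cV[R]_N),
    convex_function [set: convex_lmodType R^o]
      (fun a : R => - f i (upd x i a)).

Definition strongly_monotone (R : realType) (N : nat)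
    (f : 'I_N -> 'cV[R]_N -> R) (beta : R) : Prop :=
  forall x z : 'cV[R]_N,
    dotv (x - z) (pseudograd f x - pseudograd f z) <=
      - beta * enorm (x - z) ^+ 2.

(* `[tm m, sm m[ is the m-th communication time, `[sm m, tm m.+1[ the m-th
   silent time. *)
Definition schedule (R : realType) (tm sm : nat -> R) : Prop :=
  [/\ tm 0%N = 0,
      forall m, tm m < sm m /\ sm m < tm m.+1
    & tm n @[n --> \oo] --> +oo].

Definition comm_times (R : realType) (tm sm : nat -> R) : set R :=
  \bigcup_m [set` `[tm m, sm m[].

Definition comm_length (R : realType) (tm sm : nat -> R) (t s : R) : R :=
  fine (lebesgue_measure ([set` `[s, t[] `&` comm_times tm sm)).

Definition silent_length (R : realType) (tm sm : nat -> R) (t s : R) : R :=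
  t - s - comm_length tm sm t s.

(* With T0 = 0 this is the bare pair of inequalities for all 0 <= s < t; no
   schedule satisfies those, since comm_length vanishes as soon as s and t lie
   in one silent interval.  The constant T0 is the usual elasticity number of
   average-dwell-time conditions. *)
Definition admits_ACR (R : realType) (tm sm : nat -> R) (theta T0 : R) : Prop :=
  0 < theta < 1 /\
  forall s t : R, 0 <= s -> s < t ->
    theta * (t - s) - T0 <= comm_length tm sm t s /\
    silent_length tm sm t s <= (1 - theta) * (t - s) + T0.

Definition action_rate (R : realType) (N : nat) (f : 'I_N -> 'cV[R]_N -> R)
    (kbar : 'I_N -> R) (eps : R) (y : 'cV[R]_(N * N)) (i : 'I_N) : R :=
  eps * kbar i * partial i (f i) (estimate y i).

Definition comm_rate (R : realType) (N : nat) (A : 'M[R]_N)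
    (x : 'cV[R]_N) (y : 'cV[R]_(N * N)) (i j : 'I_N) : R :=
  - (\sum_k A i k * (ecoord y i j - ecoord y k j)
     + A i j * (ecoord y i j - x j 0)).

(* A solution on [0, +oo[.  The rate of y jumps at the switching instants,
   where y is only required to be continuous; the one-sided derivatives there
   then exist and equal the one-sided limits of the rate. *)
Definition is_solution (R : realType) (N : nat) (A : 'M[R]_N)
    (f : 'I_N -> 'cV[R]_N -> R) (kbar : 'I_N -> R) (eps : R) (tm sm : nat -> R)
    (x : R -> 'cV[R]_N) (y : R -> 'cV[R]_(N * N)) : Prop :=
  [/\ {within [set` `[0, +oo[], continuous x},
      {within [set` `[0, +oo[], continuous y},
      forall (t : R) (i : 'I_N), 0 < t ->
        is_derive t 1 (fun u : R => x u i 0) (action_rate f kbar eps (y t) i),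
      forall (m : nat) (t : R) (i j : 'I_N), tm m < t < sm m ->
        is_derive t 1 (fun u : R => ecoord (y u) i j) (comm_rate A (x t) (y t) i j)
    & forall (m : nat) (t : R) (i j : 'I_N), sm m < t < tm m.+1 ->
        is_derive t 1 (fun u : R => ecoord (y u) i j) 0].

Definition is_equilibrium (R : realType) (N : nat) (A : 'M[R]_N)
    (f : 'I_N -> 'cV[R]_N -> R) (kbar : 'I_N -> R) (eps : R) (tm sm : nat -> R)
    (xs : 'cV[R]_N) (ys : 'cV[R]_(N * N)) : Prop :=
  is_solution A f kbar eps tm sm (fun=> xs) (fun=> ys).

Definition exponentially_stable (R : realType) (N : nat) (A : 'M[R]_N)
    (f : 'I_N -> 'cV[R]_N -> R) (kbar : 'I_N -> R) (eps : R) (tm sm : nat -> R)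
    (xs : 'cV[R]_N) (ys : 'cV[R]_(N * N)) : Prop :=
  exists delta c lambda : R,
    [/\ 0 < delta, 0 < c, 0 < lambda &
      forall (x : R -> 'cV[R]_N) (y : R -> 'cV[R]_(N * N)),
        is_solution A f kbar eps tm sm x y ->
        enorm (col_mx (x 0) (y 0) - col_mx xs ys) < delta ->
        forall t : R, 0 <= t ->
          enorm (col_mx (x t) (y t) - col_mx xs ys) <=
            c * enorm (col_mx (x 0) (y 0) - col_mx xs ys) * expR (- lambda * t)].

(* The values kbar i are positive, so 0 is a neutral starting value. *)
Definition kmax (R : realType) (N : nat) (kbar : 'I_N -> R) : R :=
  \big[Num.max/0]_i kbar i.

Definition pi1 (R : realType) (N : nat) (kbar : 'I_N -> R)
    (P : 'M[R]_(N * N)) (alpha gamma4 : R) : R :=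
  alpha * kmax kbar * (gamma4 / 2 + N%:R * opnorm P).

Definition pi2 (R : realType) (N : nat) (kbar : 'I_N -> R)
    (P : 'M[R]_(N * N)) (alpha : R) : R :=
  2 * alpha * Num.sqrt N%:R * opnorm P * kmax kbar.

Definition eps_star (R : realType) (gamma3 lQ p1 p2 : R) : R :=
  Num.min (gamma3 * lQ / (gamma3 * p2 + p1 ^+ 2))
          (gamma3 ^+ 2 * p2 ^+ 2 / p1 ^+ 4).

Definition Gamma1 (R : realType) (gamma3 lQ p1 p2 eps : R) : 'M[R]_2 :=
  mx22 (eps * gamma3) (- (eps * p1)) (- (eps * p1)) (lQ - eps * p2).

Definition Gamma2 (R : realType) (gamma3 p1 p2 eps : R) : 'M[R]_2 :=
  mx22 (Num.sqrt eps * gamma3) (eps * p1) (eps * p1) (eps * p2).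

Definition Vfun (R : realType) (N : nat) (Vbar : 'cV[R]_N -> R)
    (P : 'M[R]_(N * N)) (e : 'cV[R]_N) (ex : 'cV[R]_(N * N)) : R :=
  Vbar e + dotv ex (P *m ex).

(* Vbar is a function on the closed ball of radius gamma5, represented by a
   total function whose values outside that ball are irrelevant; accordingly
   its derivative is only constrained in the open ball. *)
Definition lyapunov_bounds (R : realType) (N : nat)
    (f : 'I_N -> 'cV[R]_N -> R) (kbar : 'I_N -> R) (xs : 'cV[R]_N)
    (Vbar : 'cV[R]_N -> R) (gamma1 gamma2 gamma3 gamma4 gamma5 : R) : Prop :=
  (forall e : 'cV[R]_N, enorm e <= gamma5 ->
     gamma1 * enorm e ^+ 2 <= Vbar e <= gamma2 * enorm e ^+ 2) /\
  (forall e : 'cV[R]_N, enorm e < gamma5 ->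
     [/\ differentiable Vbar e,
         dotv (grad Vbar e)
              (diag_mx (\row_i kbar i) *m pseudograd f (e + xs))
           <= - gamma3 * enorm e ^+ 2
       & enorm (grad Vbar e) <= gamma4 * enorm e]).

(* Main.v *)
(* Along a solution, V = Vbar(e) + ex^T P ex satisfies V' <= - mu1 V in
   communication times and V' <= mu2 V in silent times, as long as |e| < gamma5.
   The average communication ratio then yields
   V(T) <= V(0) exp((mu1 + mu2) T0 - (mu1 theta - mu2 (1 - theta)) T), whose rate
   is positive exactly when theta > mu2 / (mu1 + mu2).  This estimate keeps the
   trajectories starting close to the equilibrium in the ball |e| < gamma5 / 2, so
   that the restriction on e is never active.  Any eps in (0, eps_star) would do:
   eps < eps_star only serves to make Gamma1 positive definite. *)

Require Import Defs.
From HB Require Import structures.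
From mathcomp Require Import all_boot all_order all_algebra.
From mathcomp Require Import mxtens ring lra.
From mathcomp Require Import all_classical all_reals all_analysis.

Set Implicit Arguments.
Unset Strict Implicit.
Unset Printing Implicit Defensive.

Import Order.TTheory GRing.Theory Num.Theory.
Import numFieldNormedType.Exports.

Local Open Scope classical_set_scope.
Local Open Scope ring_scope.

(** In the coordinates [e = x - xs], [ex = y - ones_tens x], the estimates obey in communication
    times a linear equation with matrix [- LBmx A], forced by the motion of [x]; in silent times
    only the forcing remains. The motion of [x] thus contributes to V' in the same way in both
    regimes and is bounded once, by a quadratic form in [(|e|, |ex|)] built from [gamma3], [pi1] and
    [pi2]. Communication adds [- ex^T Q ex], at most [- lambda_min Q * |ex|^2], which completes the
    form to minus that of [Gamma1]; in silence the form is dominated by that of [Gamma2]. Dividing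
    the extreme eigenvalues by [eta2] and [eta1] turns them into rates for V. Two obstacles shape
    the rest. V need not be differentiable at the switching instants, so a Gronwall estimate is run
    on each piece and glued by continuity. And decay on [[0, T]] presupposes [|e| < gamma5] on
    [[0, T]], which only the decay can guarantee; a first-exit argument, using the gap between
    [gamma5 / 2] and [gamma5], breaks this circle. *)

Section EuclideanSpace.
Context {R : realType}.

Lemma dotvE n (u v : 'cV[R]_n) : dotv u v = \sum_i u i 0 * v i 0.
Proof. by rewrite /dotv mxE; apply: eq_bigr => i _; rewrite mxE. Qed.

Lemma dotvC n (u v : 'cV[R]_n) : dotv u v = dotv v u.
Proof. by rewrite !dotvE; apply: eq_bigr => i _; rewrite mulrC. Qed.

Lemma dotvDr n (u v w : 'cV[R]_n) : dotv u (v + w) = dotv u v + dotv u w.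
Proof. by rewrite /dotv mulmxDr mxE. Qed.

Lemma dotvDl n (u v w : 'cV[R]_n) : dotv (u + v) w = dotv u w + dotv v w.
Proof. by rewrite dotvC dotvDr !(dotvC w). Qed.

Lemma dotvZr n a (u v : 'cV[R]_n) : dotv u (a *: v) = a * dotv u v.
Proof. by rewrite /dotv -scalemxAr mxE. Qed.

Lemma dotvZl n a (u v : 'cV[R]_n) : dotv (a *: u) v = a * dotv u v.
Proof. by rewrite dotvC dotvZr dotvC. Qed.

Lemma dotvNr n (u v : 'cV[R]_n) : dotv u (- v) = - dotv u v.
Proof. by rewrite -scaleN1r dotvZr mulN1r. Qed.

Lemma dotvNl n (u v : 'cV[R]_n) : dotv (- u) v = - dotv u v.
Proof. by rewrite dotvC dotvNr dotvC. Qed.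

Lemma dotv0 n (u : 'cV[R]_n) : dotv u 0 = 0.
Proof. by rewrite /dotv mulmx0 mxE. Qed.

Lemma dotv_mulmxl n m (A : 'M[R]_(m, n)) (u : 'cV[R]_n) (v : 'cV[R]_m) :
  dotv (A *m u) v = dotv u (A^T *m v).
Proof. by rewrite /dotv trmx_mul mulmxA. Qed.

Lemma dotvv n (v : 'cV[R]_n) : dotv v v = enorm v ^+ 2.
Proof.
rewrite /enorm sqr_sqrtr ?sumr_ge0// => [|i _]; last exact: sqr_ge0.
by rewrite dotvE; apply: eq_bigr => i _; rewrite expr2.
Qed.

Lemma enorm_ge0 n (v : 'cV[R]_n) : 0 <= enorm v.
Proof. exact: sqrtr_ge0. Qed.

Lemma enorm_sum n (v : 'cV[R]_n) : enorm v ^+ 2 = \sum_i v i 0 ^+ 2.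
Proof. by rewrite -dotvv dotvE; apply: eq_bigr => i _; rewrite expr2. Qed.

Lemma coord_le_enorm n (v : 'cV[R]_n) i : `|v i 0| <= enorm v.
Proof.
rewrite -ler_sqr ?nnegrE ?enorm_ge0// real_normK ?num_real// enorm_sum.
by rewrite (bigD1 i)//= lerDl sumr_ge0// => j _; exact: sqr_ge0.
Qed.

Lemma enorm_eq0 n (v : 'cV[R]_n) : enorm v = 0 -> v = 0.
Proof.
move=> v0; apply/matrixP => i j; rewrite ord1 mxE; apply/eqP.
by rewrite -normr_le0 -v0; exact: coord_le_enorm.
Qed.

Lemma enormZ n a (v : 'cV[R]_n) : enorm (a *: v) = `|a| * enorm v.
Proof.
apply/eqP; rewrite -(@eqrXn2 _ 2)// ?mulr_ge0 ?enorm_ge0//.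
by rewrite exprMn -!dotvv dotvZl dotvZr mulrA -expr2 real_normK ?num_real.
Qed.

Lemma enormN n (v : 'cV[R]_n) : enorm (- v) = enorm v.
Proof. by rewrite -scaleN1r enormZ normrN1 mul1r. Qed.

Lemma enorm0 n : enorm (0 : 'cV[R]_n) = 0.
Proof. by rewrite -(scale0r 0) enormZ normr0 mul0r. Qed.

Lemma dotv_le n (u v : 'cV[R]_n) : dotv u v <= enorm u * enorm v.
Proof.
have [u0|u0] := eqVneq (enorm u) 0.
  by rewrite u0 mul0r (enorm_eq0 u0) dotvC dotv0.
have [v0|v0] := eqVneq (enorm v) 0.
  by rewrite v0 mulr0 (enorm_eq0 v0) dotv0.
have uv : 0 < enorm u * enorm v by rewrite mulr_gt0// lt0r ?u0 ?v0 enorm_ge0.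
(* The square expands to [2 |u| |v| (|u| |v| - u.v)]; zero vectors were set aside so that the
   positive factor can be cancelled. *)
have : 0 <= dotv (enorm v *: u - enorm u *: v) (enorm v *: u - enorm u *: v).
  by rewrite dotvv sqr_ge0.
rewrite dotvDl !dotvDr !dotvNr !dotvNl !dotvZl !dotvZr !dotvv (dotvC v) => h.
have {h} : 0 <= 2 * (enorm u * enorm v) * (enorm u * enorm v - dotv u v) by nra.
by rewrite pmulr_rge0 ?subr_ge0// mulr_gt0.
Qed.

Lemma normr_dotv_le n (u v : 'cV[R]_n) : `|dotv u v| <= enorm u * enorm v.
Proof.
by rewrite ler_norml lerNl -dotvNr -(enormN v) dotv_le enormN dotv_le.
Qed.

Lemma ler_enormD n (u v : 'cV[R]_n) : enorm (u + v) <= enorm u + enorm v.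
Proof.
rewrite -ler_sqr ?nnegrE ?addr_ge0 ?enorm_ge0//.
rewrite -dotvv dotvDl !dotvDr !dotvv (dotvC v).
have := dotv_le u v; nra.
Qed.

(** Cauchy-Schwarz on each row, the constant being the Frobenius norm. This makes the set in
    [opnorm] bounded, so that its [sup] is an upper bound. *)
Lemma enorm_mulmx_bounded n m (A : 'M[R]_(m, n)) :
  exists2 c, 0 <= c & forall v, enorm (A *m v) <= c * enorm v.
Proof.
have sum0 : 0 <= \sum_i enorm (row i A)^T ^+ 2.
  by rewrite sumr_ge0// => i _; exact: sqr_ge0.
exists (Num.sqrt (\sum_i enorm (row i A)^T ^+ 2)) => [|v]; first exact: sqrtr_ge0.
rewrite -ler_sqr ?nnegrE ?mulr_ge0 ?enorm_ge0 ?sqrtr_ge0//.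
rewrite exprMn (sqr_sqrtr sum0) enorm_sum mulr_suml ler_sum// => i _.
have -> : (A *m v) i 0 = dotv (row i A)^T v.
  by rewrite dotvE mxE; apply: eq_bigr => j _; rewrite !mxE.
rewrite -exprMn -(@real_normK _ (dotv _ _)) ?num_real//.
by rewrite ler_sqr ?nnegrE ?mulr_ge0 ?enorm_ge0 ?normr_ge0// normr_dotv_le.
Qed.

Lemma le_opnorm n (A : 'M[R]_n) (v : 'cV[R]_n) :
  enorm v <= 1 -> enorm (A *m v) <= opnorm A.
Proof.
move=> v1; apply: ub_le_sup; last by exists v.
have [c c0 Ac] := enorm_mulmx_bounded A.
exists c => _ [w /= w1 <-]; apply: le_trans (Ac w) _.
by rewrite ler_piMr.
Qed.

Lemma opnorm_ge0 n (A : 'M[R]_n) : 0 <= opnorm A.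
Proof. by rewrite -(enorm0 n) -(mulmx0 1 A) le_opnorm// enorm0 ler01. Qed.

Lemma enorm_mulmx_le n (A : 'M[R]_n) (v : 'cV[R]_n) :
  enorm (A *m v) <= opnorm A * enorm v.
Proof.
have [v0|v0] := eqVneq (enorm v) 0.
  by rewrite v0 mulr0 (enorm_eq0 v0) mulmx0 enorm0.
have v_gt0 : 0 < enorm v by rewrite lt0r v0 enorm_ge0.
have norm_Z w : enorm ((enorm v)^-1 *: w) = (enorm v)^-1 * enorm w :> R.
  by rewrite enormZ ger0_norm ?invr_ge0 ?enorm_ge0.
rewrite -ler_pdivrMr// mulrC -norm_Z scalemxAr le_opnorm//.
by rewrite norm_Z mulVf.
Qed.

(** A vanishing norm kills the images of the unit vectors, that is, the columns. Serves to make
    [pi1] and [pi2] positive. *)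
Lemma opnorm_gt0 n (A : 'M[R]_n) : A != 0 -> 0 < opnorm A.
Proof.
move=> A0; rewrite lt0r opnorm_ge0 andbT; apply: contra A0 => /eqP A0.
apply/eqP/matrixP => i j; rewrite mxE.
have Aj : A *m (delta_mx j 0 : 'cV[R]_n) = 0.
  apply/enorm_eq0/eqP; rewrite eq_le enorm_ge0 andbT.
  by rewrite (le_trans (enorm_mulmx_le _ _))// A0 mul0r.
by move/matrixP: Aj => /(_ i 0); rewrite -colE !mxE.
Qed.

(** The filter is arbitrary and convergence is coordinatewise, so that one statement covers both the
    continuity of quadratic forms and limits along trajectories within [[0, T]]. *)
Lemma cvg_bilinear_form {T : Type} (F : set_system T) {FF : Filter F} n m
    (S : 'M[R]_(n, m)) (u : T -> 'cV[R]_n) (v : T -> 'cV[R]_m)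
    (a : 'cV[R]_n) (b : 'cV[R]_m) :
  (forall i, u s i 0 @[s --> F] --> a i 0) ->
  (forall i, v s i 0 @[s --> F] --> b i 0) ->
  dotv (u s) (S *m v s) @[s --> F] --> dotv a (S *m b).
Proof.
move=> ua vb; rewrite dotvE.
under eq_fun do rewrite dotvE.
apply: cvg_big => [|i _]; first exact: add_continuous.
apply: cvgM; first exact: ua.
rewrite mxE; under eq_fun do rewrite mxE.
apply: cvg_big => [|j _]; first exact: add_continuous.
by apply: cvgM; [exact: cvg_cst | exact: vb].
Qed.

Lemma cvg_enorm {T : Type} (F : set_system T) {FF : Filter F} n
    (u : T -> 'cV[R]_n) (a : 'cV[R]_n) :
  (forall i, u s i 0 @[s --> F] --> a i 0) -> enorm (u s) @[s --> F] --> enorm a.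
Proof.
move=> ua; rewrite /enorm.
apply: (@cvg_comp _ _ _ (fun s => \sum_i u s i 0 ^+ 2) Num.sqrt); last exact: sqrt_continuous.
apply: cvg_big => [|i _]; first exact: add_continuous.
by rewrite expr2; under eq_fun do rewrite expr2; apply: cvgM; exact: ua.
Qed.

End EuclideanSpace.

(** * Extreme eigenvalues as bounds of the Rayleigh quotient *)

Section RayleighQuotient.
Context {R : realType} {n : nat}.
Implicit Types S : 'M[R]_n.

Let continuous_quadratic_form S :
  continuous (fun v : 'rV[R]_n => dotv v^T (S *m v^T)).
Proof.
move=> v; apply: (@cvg_bilinear_form _ _ (nbhs v) (nbhs_filter v)) => i; rewrite mxE;
  under eq_fun do rewrite mxE; exact: coord_continuous.
Qed.

(** The quadratic form attains its minimum on the compact unit sphere, and the first variation shows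
    that a minimizer is an eigenvector. Row vectors appear because [eigenvalue] and the extreme
    value theorem are stated for them. *)
Lemma exists_min_eigenvector S : S^T = S -> (0 < n)%N ->
  exists a, eigenvalue S a /\ forall v, a * enorm v ^+ 2 <= dotv v (S *m v).
Proof.
move=> symS n_gt0.
pose sphere := [set v : 'rV[R]_n | enorm v^T = 1].
have sphere0 : sphere !=set0.
  exists (delta_mx 0 (Ordinal n_gt0)); apply/eqP.
  rewrite -(@eqrXn2 _ 2)// ?enorm_ge0// expr1n -dotvv dotvE.
  rewrite (bigD1 (Ordinal n_gt0))//= big1 ?addr0 => [|i /negPf i0].
    by rewrite !mxE !eqxx mulr1.
  by rewrite !mxE i0 mulr0.
have closed_sphere : closed sphere.
  have -> : sphere = (fun v : 'rV[R]_n => dotv v^T (1%:M *m v^T)) @^-1` [set 1].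
    apply/seteqP; split=> v /=; rewrite mul1mx dotvv; first by move->; rewrite expr1n.
    by move/eqP; rewrite sqrf_eq1 => /orP[/eqP//|/eqP v1]; have := enorm_ge0 v^T;
      rewrite v1 lerNr oppr0 ler10.
  apply: closed_comp; last exact: closed_eq.
  by move=> v _; exact: continuous_quadratic_form.
have bounded_sphere : bounded_set sphere.
  exists 1; split=> // M M1 v /= v1; apply: le_trans (ltW M1).
  rewrite /Num.Def.normr/= mx_normrE; apply/bigmax_leP; split=> // -[i j] _ /=.
  by rewrite ord1 -v1; have := coord_le_enorm v^T j; rewrite mxE.
have [w] := EVT_min_rV sphere0 (bounded_closed_compact bounded_sphere closed_sphere)
  (continuous_subspaceT (@continuous_quadratic_form S)).
rewrite inE /sphere/= => w1 w_min.
set a := dotv w^T (S *m w^T).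
have a_min v : a * enorm v ^+ 2 <= dotv v (S *m v).
  have [v0|v0] := eqVneq (enorm v) 0.
    by rewrite v0 (enorm_eq0 v0) mulmx0 dotv0 expr0n mulr0.
  have v_gt0 : 0 < enorm v by rewrite lt0r v0 enorm_ge0.
  have /w_min : ((enorm v)^-1 *: v)^T \in sphere.
    by rewrite inE /sphere/= trmxK enormZ ger0_norm ?invr_ge0 ?enorm_ge0// mulVf.
  rewrite trmxK -scalemxAr dotvZl dotvZr mulrA -expr2 exprVn.
  by rewrite ler_pdivlMl ?exprn_gt0// mulrC.
exists a; split=> //; apply/eigenvalueP; exists w; last first.
  apply/eqP => w0; move: w1; rewrite w0 trmx0 enorm0 => /eqP.
  by rewrite eq_sym oner_eq0.
apply: trmx_inj; rewrite trmx_mul symS linearZ/=.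
(* [r] is the residual of the eigenvector equation. Moving from [u] in the direction [r] changes the
   form minus [a |.|^2] by [2 t |r|^2] at first order, so a nonzero [r] contradicts minimality for
   small negative [t]. *)
set u := w^T; have [r Er] : exists r, r = S *m u - a *: u by eexists.
have Su : S *m u = r + a *: u by rewrite Er subrK.
have form_ge0 t : 0 <= 2 * t * enorm r ^+ 2 + t ^+ 2 * (dotv r (S *m r) - a * enorm r ^+ 2).
  have := a_min (u + t *: r); rewrite -!dotvv mulmxDr -scalemxAr.
  rewrite !dotvDl !dotvDr !dotvZl !dotvZr -/a dotvv w1 expr1n.
  rewrite [dotv u (S *m r)]dotvC dotv_mulmxl symS (dotvC u r).
  have -> : dotv r (S *m u) = dotv r r + a * dotv r u.
    by rewrite Su dotvDr dotvZr.
  by rewrite dotvv; nra.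
suff /enorm_eq0/eqP : enorm r = 0 by rewrite Er subr_eq0 => /eqP.
apply/eqP; rewrite -sqrf_eq0 eq_le sqr_ge0 andbT leNgt; apply/negP => r_gt0.
set c := dotv r (S *m r) - _ in form_ge0.
(* This step is short enough for the linear term to dominate: its length times [c] is at most
   [|r|^2], below the [2 |r|^2] that would be needed. The summand [1] keeps the denominator
   positive. *)
have := form_ge0 (- (enorm r ^+ 2 / (1 + `|c|))).
have c1 : 0 < 1 + `|c| by rewrite ltr_pwDl.
set t := enorm r ^+ 2 / (1 + `|c|).
have t_gt0 : 0 < t by rewrite divr_gt0.
have tc : t * c < enorm r ^+ 2 *+ 2.
  apply: (@le_lt_trans _ _ (t * (1 + `|c|))).
    by rewrite ler_wpM2l ?(ltW t_gt0)//; have := ler_norm c; lra.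
  by rewrite /t divfK ?gt_eqF// mulr2n ltrDl.
by nra.
Qed.

(** The minimum of the Rayleigh quotient is an eigenvalue and, tested on eigenvectors, a lower bound
    of all eigenvalues; hence it is the infimum defining [lambda_min]. *)
Lemma lambda_minP S : S^T = S -> (0 < n)%N ->
  eigenvalue S (lambda_min S) /\
  forall v, lambda_min S * enorm v ^+ 2 <= dotv v (S *m v).
Proof.
move=> symS n_gt0; have [a [Sa a_min]] := exists_min_eigenvector symS n_gt0.
suff -> : lambda_min S = a by [].
have a_lb : lbound [set b : R | eigenvalue S b] a.
  move=> b /= /eigenvalueP[w wS w0].
  have w_gt0 : 0 < enorm w^T.
    rewrite lt0r enorm_ge0 andbT; apply: contra w0 => /eqP/enorm_eq0 w0.
    by rewrite -(trmxK w) w0 trmx0.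
  have := a_min w^T; rewrite -[S in S *m _]symS -trmx_mul wS linearZ/= dotvZr dotvv.
  by rewrite ler_pM2r ?exprn_gt0.
apply/eqP; rewrite eq_le lb_le_inf//; last by exists a.
by rewrite andbT ge_inf//; exists a.
Qed.

(** [lambda_minP] for [- S]: the infimum is minus the supremum of the opposite set, and the spectrum
    of [- S] is opposite to that of [S]. *)
Lemma lambda_max_ge S v : S^T = S -> (0 < n)%N ->
  dotv v (S *m v) <= lambda_max S * enorm v ^+ 2.
Proof.
move=> symS n_gt0.
have symNS : (- S)^T = - S by rewrite linearN/= symS.
have [_ /(_ v)] := lambda_minP symNS n_gt0.
rewrite mulNmx dotvNr lerNr -mulNr; congr (_ <= _ * _).
rewrite /lambda_min /lambda_max /inf opprK; congr sup.
apply/seteqP; split=> [_ [b /= /eigenvalueP[w wS w0] <-]|b /= /eigenvalueP[w wS w0]].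
  apply/eigenvalueP; exists w => //.
  by rewrite scaleNr -wS mulmxN opprK.
exists (- b); rewrite ?opprK//=; apply/eigenvalueP; exists w => //.
by rewrite mulmxN wS scaleNr.
Qed.

Lemma lambda_min_gt0 S : posdefmx S -> (0 < n)%N -> 0 < lambda_min S.
Proof.
move=> [symS S_gt0] n_gt0; have [/eigenvalueP[w wS w0] _] := lambda_minP symS n_gt0.
have w_gt0 : 0 < enorm w^T.
  rewrite lt0r enorm_ge0 andbT; apply: contra w0 => /eqP/enorm_eq0 w0.
  by rewrite -(trmxK w) w0 trmx0.
have /S_gt0 : w^T != 0 by apply: contra w0 => /eqP w0; rewrite -(trmxK w) w0 trmx0.
rewrite -[S in S *m _]symS -trmx_mul wS linearZ/= dotvZr dotvv.
by rewrite pmulr_lgt0// exprn_gt0.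
Qed.

End RayleighQuotient.

(** * Binary quadratic forms *)

Section QuadraticForms2.
Context {R : realType}.

Let col2 (a b : R) : 'cV[R]_2 := \col_i (if i == 0 then a else b).

Lemma col2_mx22 (p q s a b : R) :
  dotv (col2 a b) (mx22 p q q s *m col2 a b) =
    p * a ^+ 2 + 2 * q * a * b + s * b ^+ 2.
Proof.
rewrite dotvE !big_ord_recl big_ord0 !mxE/= !big_ord_recl !big_ord0 !mxE/=.
by rewrite /lift/=; ring.
Qed.

Lemma enorm_col2 (a b : R) : enorm (col2 a b) ^+ 2 = a ^+ 2 + b ^+ 2.
Proof. by rewrite enorm_sum !big_ord_recl big_ord0 !mxE/= addr0. Qed.

Lemma mx22_sym (p q s : R) : (mx22 p q q s)^T = mx22 p q q s.
Proof. by apply/matrixP => i j; rewrite !mxE; case: ifP; case: ifP. Qed.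

Lemma lambda_min_mx22_le (p q s a b : R) :
  lambda_min (mx22 p q q s) * (a ^+ 2 + b ^+ 2) <=
    p * a ^+ 2 + 2 * q * a * b + s * b ^+ 2.
Proof.
by rewrite -col2_mx22 -enorm_col2; apply: (lambda_minP (mx22_sym p q s) _).2.
Qed.

Lemma lambda_max_mx22_ge (p q s a b : R) :
  p * a ^+ 2 + 2 * q * a * b + s * b ^+ 2 <=
    lambda_max (mx22 p q q s) * (a ^+ 2 + b ^+ 2).
Proof. by rewrite -col2_mx22 -enorm_col2; exact: lambda_max_ge (mx22_sym p q s) _. Qed.

(** Sylvester's criterion in dimension two, by completing the square after multiplication by [p]. *)
Lemma lambda_min_mx22_gt0 (p q s : R) :
  0 < p -> q ^+ 2 < p * s -> 0 < lambda_min (mx22 p q q s).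
Proof.
move=> p0 qps; apply: lambda_min_gt0 => //; split; first exact: mx22_sym.
move=> v v0; have -> : v = col2 (v 0 0) (v 1 0).
  by apply/matrixP => i j; rewrite ord1 mxE; case: ifPn => [/eqP->//|];
    case: i => -[|[]]// ? _; congr (v _ _); exact: val_inj.
rewrite col2_mx22; set a := v 0 0; set b := v 1 0.
rewrite -(pmulr_rgt0 _ p0).
have -> : p * (p * a ^+ 2 + 2 * q * a * b + s * b ^+ 2) =
  (p * a + q * b) ^+ 2 + (p * s - q ^+ 2) * b ^+ 2 by ring.
have [b0|b0] := eqVneq b 0; last first.
  by rewrite ltr_wpDl ?sqr_ge0// mulr_gt0 ?subr_gt0// exprn_even_gt0.
rewrite b0 mulr0 addr0 expr0n/= mulr0 addr0 exprn_even_gt0//= mulf_neq0 ?(gt_eqF p0)//.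
apply: contra v0 => /eqP a0; apply/eqP/matrixP => i j; rewrite ord1 mxE.
case: i => -[|[]]// ?; [rewrite -[RHS]a0|rewrite -[RHS]b0]; congr (v _ _); exact: val_inj.
Qed.

End QuadraticForms2.

(** * Block structure of the estimates and matrix form of the consensus dynamics *)

Section Tensor.
Context {R : realType}.

Lemma sum_mxtens_index m n (F : 'I_(m * n) -> R) :
  \sum_p F p = \sum_i \sum_j F (mxtens_index (i, j)).
Proof.
rewrite pair_big/= (reindex (@mxtens_index m n)).
  by apply: eq_bigr => -[].
by exists (@mxtens_unindex m n) => p _; [exact: mxtens_indexK | exact: mxtens_unindexK].
Qed.

Context {N : nat}.
Implicit Types (x : 'cV[R]_N) (y : 'cV[R]_(N * N)) (A : 'M[R]_N).

Lemma ones_tensE x i j : ones_tens x (mxtens_index (i, j)) 0 = x j 0.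
Proof. by rewrite mxE mxtens_indexK. Qed.

Lemma ones_tensD x z : ones_tens (x + z) = ones_tens x + ones_tens z.
Proof. by apply/matrixP => i j; rewrite !mxE. Qed.

Lemma ones_tensZ a x : ones_tens (a *: x) = a *: ones_tens x.
Proof. by apply/matrixP => i j; rewrite !mxE. Qed.

Lemma ones_tensN x : ones_tens (- x) = - ones_tens x.
Proof. by rewrite -scaleN1r ones_tensZ scaleN1r. Qed.

Lemma enorm_ones_tens x : enorm (ones_tens x) = Num.sqrt N%:R * enorm x.
Proof.
apply/eqP; rewrite -(@eqrXn2 _ 2)// ?mulr_ge0 ?sqrtr_ge0 ?enorm_ge0//.
rewrite exprMn (@sqr_sqrtr _ N%:R) ?ler0n// !enorm_sum sum_mxtens_index.
under eq_bigr do under eq_bigr do rewrite ones_tensE.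
by rewrite sumr_const card_ord mulr_natl.
Qed.

Lemma estimate_ones_tens x i : estimate (ones_tens x) i = x.
Proof. by apply/matrixP => j k; rewrite ord1 mxE /ecoord ones_tensE. Qed.

Lemma sum_enorm_estimate y : \sum_i enorm (estimate y i) ^+ 2 = enorm y ^+ 2.
Proof.
rewrite [RHS]enorm_sum sum_mxtens_index; apply: eq_bigr => i _.
by rewrite enorm_sum; apply: eq_bigr => j _; rewrite mxE.
Qed.

(** The true action [x j 0] cancels in [y_ij - y_kj], so the Laplacian part can be written with the
    errors [y - ones_tens x]; the term [a_ij (y_ij - x_j)] is the diagonal part [Bmx A]. *)
Lemma comm_rateE A x y i j :
  comm_rate A x y i j =
    - (LBmx A *m (y - ones_tens x)) (mxtens_index (i, j)) 0.
Proof.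
set ex := y - ones_tens x.
have exE k l : ex (mxtens_index (k, l)) 0 = ecoord y k l - x l 0.
  by rewrite mxE [X in _ + X]mxE ones_tensE.
clearbody ex; rewrite /comm_rate mulmxDl mxE; congr (- (_ + _)); last first.
  by rewrite /Bmx mul_diag_mx !mxE mxtens_indexK exE.
rewrite [RHS]mxE sum_mxtens_index.
transitivity (\sum_k laplacian A i k * ex (mxtens_index (k, j)) 0); last first.
  apply: eq_bigr => k _; rewrite (bigD1 j)//= big1 ?addr0 => [|l /negPf lj].
    by rewrite tensmxE [1%:M _ _]mxE eqxx mulr1.
  by rewrite tensmxE [1%:M _ _]mxE eq_sym lj mulr0 mul0r.
transitivity (\sum_k (A i k * ex (mxtens_index (i, j)) 0 - A i k * ex (mxtens_index (k, j)) 0)).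
  by apply: eq_bigr => k _; rewrite !exE; ring.
rewrite sumrB -mulr_suml.
rewrite /laplacian; under [RHS]eq_bigr do rewrite !mxE mulrBl.
rewrite sumrB; congr (_ - _); rewrite [RHS](bigD1 i)//= [X in _ + X]big1 ?addr0 => [|k /negPf ki].
  by rewrite eqxx mulr1n.
by rewrite eq_sym ki mulr0n mul0r.
Qed.

End Tensor.

(** * Pointwise bounds on the velocities *)

Section PointwiseEstimates.
Context {R : realType} {N : nat}.
Implicit Types (x e : 'cV[R]_N) (y ex : 'cV[R]_(N * N)).

Lemma kmax_ge (kbar : 'I_N -> R) i : kbar i <= kmax kbar.
Proof. exact: le_bigmax. Qed.

Lemma kmax_ge0 (kbar : 'I_N -> R) : 0 <= kmax kbar.
Proof. exact: bigmax_ge_id. Qed.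

Lemma enorm_gain_le (kbar : 'I_N -> R) x : (forall i, 0 < kbar i) ->
  enorm (diag_mx (\row_i kbar i) *m x) <= kmax kbar * enorm x.
Proof.
move=> kbar0; rewrite -ler_sqr ?nnegrE ?mulr_ge0 ?kmax_ge0 ?enorm_ge0//.
rewrite exprMn !enorm_sum mulr_sumr ler_sum// => i _.
rewrite mul_diag_mx !mxE exprMn ler_wpM2r ?sqr_ge0//.
by rewrite ler_sqr ?nnegrE ?kmax_ge0 ?kmax_ge// ltW.
Qed.

(** The velocity of [x] up to the gains: every player evaluates its partial derivative at its own
    estimate. It equals [pseudograd f x] when all estimates equal [x]. *)
Definition estimated_pseudograd (f : 'I_N -> 'cV[R]_N -> R) y : 'cV[R]_N :=
  \col_i partial i (f i) (estimate y i).

(** No factor depending on [N] arises: component [i] is controlled by block [i] of the error alone,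
    and the squared blocks sum to the squared norm. *)
Lemma enorm_estimated_pseudogradB f alpha x y :
  0 < alpha -> lipschitz_partials f alpha ->
  enorm (estimated_pseudograd f y - pseudograd f x) <=
    alpha * enorm (y - ones_tens x).
Proof.
move=> alpha0 lip; rewrite -ler_sqr ?nnegrE ?mulr_ge0 ?enorm_ge0 ?(ltW alpha0)//.
rewrite exprMn -sum_enorm_estimate enorm_sum mulr_sumr ler_sum// => i _.
rewrite !mxE -exprMn -[X in X <= _]real_normK ?num_real//.
rewrite ler_sqr ?nnegrE ?normr_ge0 ?mulr_ge0 ?enorm_ge0 ?(ltW alpha0)//.
suff -> : estimate (y - ones_tens x) i = estimate y i - x by exact: lip.
by apply/matrixP => j k; rewrite !mxE /ecoord !mxE ord1 mxtens_indexK.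
Qed.

(** The previous bound for the exact estimates [ones_tens x]; the factor [Num.sqrt N%:R] is the norm
    growth under [ones_tens]. *)
Lemma enorm_pseudogradB f alpha x z :
  0 < alpha -> lipschitz_partials f alpha ->
  enorm (pseudograd f x - pseudograd f z) <= alpha * (Num.sqrt N%:R * enorm (x - z)).
Proof.
move=> alpha0 lip; rewrite -enorm_ones_tens ones_tensD ones_tensN.
suff <- : estimated_pseudograd f (ones_tens x) = pseudograd f x.
  exact: enorm_estimated_pseudogradB.
by apply/matrixP => i j; rewrite !mxE estimate_ones_tens.
Qed.

(** As [P] is symmetric, both summands of the Lyapunov equation give the same scalar. The left side
    is the derivative of [ex^T P ex] under the unforced error equation. *)
Lemma lyapunov_form (A : 'M[R]_N) (P Q : 'M[R]_(N * N)) ex : P^T = P ->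
  (LBmx A)^T *m P + P *m LBmx A = Q ->
  2 * dotv ex (P *m (- (LBmx A *m ex))) = - dotv ex (Q *m ex).
Proof.
move=> symP <-; rewrite mulmxDl dotvDr mulmxN dotvNr -!mulmxA.
have -> : dotv ex ((LBmx A)^T *m (P *m ex)) = dotv ex (P *m (LBmx A *m ex)).
  by rewrite -dotv_mulmxl dotvC dotv_mulmxl symP.
by ring.
Qed.

(* The part of dV/dt due to the motion of x, in both communication and silent
   times. *)
Lemma action_drift_le f (kbar : 'I_N -> R) (P : 'M[R]_(N * N))
    (alpha gamma3 gamma4 eps : R) (g xs x : 'cV[R]_N) y :
  0 < alpha -> lipschitz_partials f alpha -> (forall i, 0 < kbar i) ->
  0 < eps ->
  pseudograd f xs = 0 ->
  dotv g (diag_mx (\row_i kbar i) *m pseudograd f x) <= - gamma3 * enorm (x - xs) ^+ 2 ->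
  enorm g <= gamma4 * enorm (x - xs) ->
  forall ex v, ex = y - ones_tens x ->
  v = \col_i action_rate f kbar eps y i ->
  dotv g v - 2 * dotv ex (P *m ones_tens v) <=
    - (eps * gamma3) * enorm (x - xs) ^+ 2 +
    2 * (eps * pi1 kbar P alpha gamma4) * enorm (x - xs) * enorm ex +
    eps * pi2 kbar P alpha * enorm ex ^+ 2.
Proof.
move=> alpha0 lip kbar0 eps0 Gxs gG gle ex v ex_def ->.
set K := diag_mx _ in gG; set F := estimated_pseudograd f y.
have -> : \col_i action_rate f kbar eps y i = eps *: (K *m F).
  by apply/matrixP => i j; rewrite mul_diag_mx !mxE /action_rate mulrA.
have k0 := kmax_ge0 kbar.
set a := enorm (x - xs) in gG gle *; set b := enorm ex.
have a0 : 0 <= a := enorm_ge0 _. have b0 : 0 <= b := enorm_ge0 _.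
have F_G : enorm (K *m (F - pseudograd f x)) <= kmax kbar * (alpha * b).
  rewrite (le_trans (enorm_gain_le _ kbar0))// ler_wpM2l//.
  by rewrite /b ex_def; exact: enorm_estimated_pseudogradB.
have F_le : enorm (K *m F) <= kmax kbar * (alpha * b + alpha * (Num.sqrt N%:R * a)).
  (* Since [pseudograd f xs = 0], the Lipschitz bound controls [pseudograd f x] itself. *)
  rewrite (le_trans (enorm_gain_le _ kbar0))// ler_wpM2l//.
  rewrite -(subrK (pseudograd f x) F) (le_trans (ler_enormD _ _))// lerD//.
    by rewrite /b ex_def; exact: enorm_estimated_pseudogradB.
  by have := enorm_pseudogradB x xs alpha0 lip; rewrite Gxs subr0.
(* [F] splits into [pseudograd f x], whose pairing with [g] is dissipative, and the error made by
   estimating. *)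
have g_le : dotv g (K *m F) <= - gamma3 * a ^+ 2 + gamma4 * a * (kmax kbar * (alpha * b)).
  rewrite -(subrK (pseudograd f x) F) mulmxDr dotvDr addrC lerD//.
  rewrite (le_trans (dotv_le _ _))// ler_pM ?enorm_ge0//.
have N0 : 0 <= Num.sqrt N%:R :> R := sqrtr_ge0 _.
have NN : Num.sqrt N%:R * Num.sqrt N%:R = N%:R :> R by rewrite -expr2 sqr_sqrtr ?ler0n.
have op0 : 0 <= opnorm P * b by rewrite (le_trans _ (enorm_mulmx_le P ex)) ?enorm_ge0.
have P_le : - dotv ex (P *m ones_tens (K *m F)) <= b * (opnorm P *
    (Num.sqrt N%:R * (kmax kbar * (alpha * b + alpha * (Num.sqrt N%:R * a))))).
  rewrite -dotvNr (le_trans (dotv_le _ _))// ler_wpM2l// enormN.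
  rewrite (le_trans (enorm_mulmx_le _ _))// enorm_ones_tens.
  by rewrite ler_wpM2l ?opnorm_ge0// ler_wpM2l.
rewrite dotvZr ones_tensZ -scalemxAr dotvZr /pi1 /pi2.
have -> : eps * dotv g (K *m F) - 2 * (eps * dotv ex (P *m ones_tens (K *m F))) =
  eps * (dotv g (K *m F) + 2 * - dotv ex (P *m ones_tens (K *m F))) by ring.
have -> : forall p s : R, - (eps * gamma3) * a ^+ 2 + 2 * (eps * p) * a * b + eps * s * b ^+ 2 =
  eps * (- gamma3 * a ^+ 2 + 2 * p * a * b + s * b ^+ 2) by move=> p s; ring.
(* Up to [alpha] and [kmax kbar], the coefficient of [a * b] is [gamma4] plus [2 N |P|], where [N]
   is the product of the square roots from [ones_tens] and from the Lipschitz bound: this is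
   [2 * pi1]. The coefficient of [b ^+ 2] is [pi2], so what remains is an equality. *)
rewrite ler_pM2l// (le_trans (lerD g_le (ler_wpM2l _ P_le)))//.
move: NN; set r := Num.sqrt _ => NN.
by rewrite -NN le_eqVlt; apply/orP; left; apply/eqP; field.
Qed.

End PointwiseEstimates.

(** * Gronwall's inequality and a first-exit principle *)

Section Gronwall.
Context {R : realType}.

(** [v t * expR (- k * t)] is nonincreasing. The derivative is required in the open interval only,
    so that the endpoints may be switching instants. *)
Lemma le_expR_of_derive_le (v : R -> R) a b k : a <= b ->
  {within `[a, b], continuous v} ->
  (forall t, a < t < b -> exists2 dv, is_derive t 1 v dv & dv <= k * v t) ->
  v b <= v a * expR (k * (b - a)).
Proof.
move=> ab v_cont dv_le.
pose g t := v t * expR (- k * t).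
have dg t : a < t < b -> exists2 d, is_derive t 1 g d & d <= 0.
  move=> /dv_le[d vd d_le].
  have de : is_derive t 1 (fun t => expR (- k * t)) (expR (- k * t) * (- k)).
    have dk : is_derive t 1 ((- k) \*: @id R) (- k).
      by apply: is_derive_eq; rewrite /GRing.scale/= mulr1.
    exact: (@is_derive1_comp _ expR ((- k) \*: id)).
  exists (v t * (expR (- k * t) * - k) + expR (- k * t) * d).
    exact: is_deriveM.
  by rewrite mulrCA -mulrDr pmulr_rle0 ?expR_gt0// mulrN mulrC; lra.
have g_le : g b <= g a.
  apply: (@ler0_derive1_le_cc _ g a b) => //.
  - by move=> t; rewrite in_itv/= => /dg[d []].
  - by move=> t; rewrite in_itv/= => /dg[d td]; rewrite derive1E derive_val.
  - move=> t; apply: cvgM; first exact: v_cont.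
    apply: continuous_subspaceT => s.
    apply: continuous_comp; last exact: continuous_expR.
    exact: mulrl_continuous.
  - by rewrite in_itv/= ab lexx.
  - by rewrite in_itv/= ab lexx.
move: g_le; rewrite /g -ler_pdivlMr ?expR_gt0// -expRN -mulrA -expRD.
by rewrite (_ : - k * a + - (- k * b) = k * (b - a)) //; ring.
Qed.

(* At the first time where g reaches [r, +oo[, the intermediate value theorem
   gives g = r, so that the last hypothesis applies and is contradictory. *)
Lemma lt_of_no_first_exit (g : R -> R) r :
  {within `[0, +oo[, continuous g} -> g 0 < r ->
  (forall t, 0 <= t -> (forall s, 0 <= s <= t -> g s <= r) -> g t < r) ->
  forall t, 0 <= t -> g t < r.
Proof.
move=> g_cont g0 step t t0; rewrite ltNge; apply/negP => rt.
pose S := [set s | 0 <= s <= t /\ r <= g s].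
have infS : has_inf S.
  split; first by exists t; split=> //; rewrite t0 lexx.
  by exists 0 => s [/andP[]].
pose a := inf S.
have a0 : 0 <= a by apply: lb_le_inf => [|s [/andP[]]//]; exact: infS.1.
have lt_a s : 0 <= s -> s < a -> g s < r.
  move=> s0 sa; rewrite ltNge; apply/negP => rs.
  have [st|ts] := leP s t.
    have : a <= s by apply: ge_inf; [exact: infS.2|split=> //; rewrite s0].
    by rewrite leNgt sa.
  have : a <= t by apply: ge_inf; [exact: infS.2|split=> //; rewrite t0 lexx].
  by rewrite leNgt (lt_trans ts sa).
have cont_seg b c : 0 <= b -> {within `[b, c], continuous g}.
  move=> b0; apply: continuous_subspaceW g_cont => u /=.
  by rewrite !in_itv/= => /andP[bu _]; rewrite (le_trans b0).
have ga : g a <= r.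
  rewrite leNgt; apply/negP => ra.
  have : Num.min (g 0) (g a) <= r <= Num.max (g 0) (g a).
    by rewrite ge_min le_max (ltW g0) (ltW ra) orbT.
  move=> /(IVT a0 (cont_seg 0 a (lexx _)))[c]; rewrite in_itv/= => /andP[c0 ca] gc.
  have [ca'|ac] := ltP c a; first by have := lt_a _ c0 ca'; rewrite gc ltxx.
  by move: ra; rewrite -gc (_ : c = a) ?ltxx//; apply/eqP; rewrite eq_le ca.
have {}ga : g a < r.
  apply: step => // s /andP[s0]; rewrite le_eqVlt => /predU1P[->//|sa].
  exact/ltW/lt_a.
(* The strict inequality at [a] persists nearby, whereas [S] has points arbitrarily close to its
   infimum. Continuity is known only within the half-line, hence the restricted neighbourhood. *)
have [d /= d0 d_ball] : \forall s \near within `[0, +oo[ (nbhs a), g s < r.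
  move/subspace_continuousP: g_cont => /(_ a).
  rewrite /= in_itv/= a0 => /(_ isT) g_cont.
  exact: (cvgr_lt _ g_cont).
have [s [/andP[s0 st] rs] sad] := inf_adherent d0 infS.
have as_ : a <= s by apply: ge_inf; [exact: infS.2|split=> //; rewrite s0].
have : g s < r.
  apply: d_ball; last by rewrite /= in_itv/= s0.
  by rewrite /ball/= distrC ger0_norm ?subr_ge0// ltrBlDl.
by rewrite ltNge rs.
Qed.

End Gronwall.

(** * Communication length, and decay across the switching instants *)

Section Schedule.
Context {R : realType} (tm sm : nat -> R).
Hypothesis tm_sm : schedule tm sm.

Lemma schedule_tm_le m n : (m <= n)%N -> tm m <= tm n.
Proof.
have [_ lt_ts _] := tm_sm; move=> /subnK <-; elim: (n - m)%N => [|k IHk].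
  by rewrite lexx.
by have [lt1 lt2] := lt_ts (k + m)%N; rewrite addSn (le_trans IHk)// ltW// (lt_trans lt1).
Qed.

Lemma schedule_tm_ge0 m : 0 <= tm m.
Proof. by have [<- _ _] := tm_sm; exact: schedule_tm_le. Qed.

Lemma schedule_tm_unbounded T : exists m, T <= tm m.
Proof.
have [_ _ /cvgryPge/(_ T)[m _ Tm]] := tm_sm.
by exists m; apply: Tm => /=.
Qed.

Lemma measurable_comm_times : measurable (comm_times tm sm).
Proof. by apply: bigcup_measurable => m _; exact: measurable_itv. Qed.

Lemma comm_lengthD s t : 0 <= s <= t ->
  comm_length tm sm t 0 = comm_length tm sm s 0 + comm_length tm sm t s.
Proof.
move=> /andP[s0 st].
(* [fine] is additive on finite values; these measures are bounded by the length of the interval. *)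
have fin a b : lebesgue_measure ([set` `[a, b[] `&` comm_times tm sm) \is a fin_num.
  rewrite ge0_fin_numE// (@le_lt_trans _ _ (lebesgue_measure [set` `[a, b[]))//.
    apply: le_measure; rewrite ?inE.
    - by apply: measurableI; [exact: measurable_itv|exact: measurable_comm_times].
    - exact: measurable_itv.
    - exact: subIsetl.
  by rewrite lebesgue_measure_itv/=; case: ifP => _; rewrite ?ltry// ltey.
rewrite /comm_length -fineD ?fin// -measureU.
- by rewrite -setIUl -itv_bndbnd_setU.
- by apply: measurableI; [exact: measurable_itv|exact: measurable_comm_times].
- by apply: measurableI; [exact: measurable_itv|exact: measurable_comm_times].
- apply/seteqP; split=> // u /= []; rewrite !in_itv/= => -[/andP[_ us] _].
  by move=> [/andP[su _] _]; move: us; rewrite ltNge su.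
Qed.

Lemma comm_length_comm m s t : tm m <= s <= t -> t <= sm m ->
  comm_length tm sm t s = t - s.
Proof.
move=> /andP[ms st] tsm.
rewrite /comm_length (_ : _ `&` _ = [set` `[s, t[]).
  rewrite lebesgue_measure_itv/= lte_fin; case: ltP => //= ts.
  by apply/eqP; rewrite eq_sym subr_eq0 eq_le st ts.
apply/seteqP; split=> u /=; rewrite in_itv/=; first by case.
move=> /andP[su ut]; split; first by rewrite su.
by exists m => //=; rewrite in_itv/= (le_trans ms)//= (lt_le_trans ut).
Qed.

Lemma comm_length_silent m s t : sm m <= s -> t <= tm m.+1 ->
  comm_length tm sm t s = 0.
Proof.
move=> ms tm1; rewrite /comm_length (_ : _ `&` _ = set0) ?measure0//.
apply/seteqP; split=> // u /=; rewrite in_itv/= => -[/andP[su ut] [k _ /=]].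
rewrite in_itv/= => /andP[ku uk].
have [_ lt_ts _] := tm_sm.
have [km|mk] := leqP k m.
  have : sm k <= sm m.
    move: km; rewrite leq_eqVlt => /predU1P[->//|km].
    have := schedule_tm_le km; have := lt_ts k; have := lt_ts m; lra.
  by rewrite leNgt (le_lt_trans (le_trans ms su)).
by have := schedule_tm_le mk; rewrite leNgt (le_lt_trans ku)// (lt_le_trans ut).
Qed.

(** Inside one communication or silent time the exponent grows by [- mu1] or [mu2] times the elapsed
    time, which is the Gronwall factor there. Additivity of [comm_length] chains these factors, and
    continuity of [v] carries the bound through the switching instants. *)
Lemma intermittent_decay (v : R -> R) mu1 mu2 T : 0 <= T ->
  {within `[0, T], continuous v} ->
  (forall m t, t < T -> tm m < t < sm m ->
     exists2 dv, is_derive t 1 v dv & dv <= - mu1 * v t) ->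
  (forall m t, t < T -> sm m < t < tm m.+1 ->
     exists2 dv, is_derive t 1 v dv & dv <= mu2 * v t) ->
  v T <= v 0 * expR (- mu1 * comm_length tm sm T 0 + mu2 * silent_length tm sm T 0).
Proof.
move=> T0 v_cont dv_comm dv_silent; have [tm0 lt_ts _] := tm_sm.
pose phi t := - mu1 * comm_length tm sm t 0 + mu2 * silent_length tm sm t 0.
have cont_seg s t : 0 <= s -> t <= T -> {within `[s, t], continuous v}.
  move=> s0 tT; apply: continuous_subspaceW v_cont => u /=.
  rewrite !in_itv/= => /andP[su ut].
  by rewrite (le_trans s0 su) (le_trans ut).
have step_comm m s t : tm m <= s <= t -> t <= sm m -> t <= T ->
    v s <= v 0 * expR (phi s) -> v t <= v 0 * expR (phi t).
  move=> mst tsm tT vs; have /andP[ms st] := mst.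
  have s0 := le_trans (schedule_tm_ge0 m) ms.
  have s0t : 0 <= s <= t by rewrite s0.
  apply: (@le_trans _ _ (v s * expR (- mu1 * (t - s)))).
    apply: le_expR_of_derive_le => // [|u /andP[su ut]]; first exact: cont_seg.
    apply: (dv_comm m); first by rewrite (lt_le_trans ut).
    by rewrite (le_lt_trans ms)//= (lt_le_trans ut).
  rewrite (le_trans (ler_wpM2r (expR_ge0 _) vs))// -mulrA -expRD.
  rewrite (_ : phi s + _ = phi t)// /phi /silent_length (comm_lengthD s0t).
  by rewrite (comm_length_comm mst tsm); ring.
have step_silent m s t : sm m <= s -> s <= t -> t <= tm m.+1 -> t <= T ->
    v s <= v 0 * expR (phi s) -> v t <= v 0 * expR (phi t).
  move=> ms st tm1 tT vs.
  have s0 : 0 <= s.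
    by rewrite (le_trans (schedule_tm_ge0 m))// (le_trans (ltW (lt_ts m).1)).
  have s0t : 0 <= s <= t by rewrite s0.
  apply: (@le_trans _ _ (v s * expR (mu2 * (t - s)))).
    apply: le_expR_of_derive_le => // [|u /andP[su ut]]; first exact: cont_seg.
    apply: (dv_silent m); first by rewrite (lt_le_trans ut).
    by rewrite (le_lt_trans ms)//= (lt_le_trans ut).
  rewrite (le_trans (ler_wpM2r (expR_ge0 _) vs))// -mulrA -expRD.
  rewrite (_ : phi s + _ = phi t)// /phi /silent_length (comm_lengthD s0t).
  by rewrite (comm_length_silent ms tm1); ring.
(* Induction on the number of periods, all times up to [tm m] at once; [tm] being unbounded, some
   [m] covers [T]. *)
suff bound m t : 0 <= t <= T -> t <= tm m -> v t <= v 0 * expR (phi t).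
  by have [m Tm] := schedule_tm_unbounded T; apply: (bound m); rewrite ?T0 ?lexx.
elim: m t => [|m IHm] t /andP[t0 tT].
  rewrite tm0 => t0'; have -> : t = 0 by apply/eqP; rewrite eq_le t0 t0'.
  rewrite /phi /silent_length (_ : comm_length tm sm 0 0 = 0).
    by rewrite !subr0 !mulr0 addr0 expR0 mulr1.
  by rewrite (@comm_length_comm 0%N) ?tm0 ?subrr ?lexx//; have := lt_ts 0%N; rewrite tm0; lra.
have tm_ge0 := schedule_tm_ge0 m.
have [lt1 lt2] := lt_ts m.
have [t_le|m_lt] := leP t (tm m); first by move=> _; apply: IHm => //; rewrite t0.
have v_tm : v (tm m) <= v 0 * expR (phi (tm m)).
  by apply: IHm; rewrite ?tm_ge0 ?lexx//= (le_trans (ltW m_lt)).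
have [t_le|s_lt tm1] := leP t (sm m).
  by move=> _; apply: (step_comm m (tm m)) => //; rewrite lexx ltW.
apply: (step_silent m (sm m)) => //; first exact: ltW.
apply: (step_comm m (tm m)) => //; first by rewrite lexx ltW.
exact: le_trans (ltW s_lt) tT.
Qed.

End Schedule.

(** * Chain rules and the first-order condition *)

Section DerivativeAlongTrajectory.
Context {R : realType}.

Lemma diff_dotv_grad n (g : 'cV[R]_n -> R) e v :
  differentiable g e -> 'd g e v = dotv (grad g e) v.
Proof.
move=> dg; have vE : v = \sum_i v i 0 *: (delta_mx i 0 : 'cV[R]_n).
  by rewrite [LHS]matrix_sum_delta; apply: eq_bigr => i _; rewrite big_ord1.
rewrite [in LHS]vE linear_sum dotvE; apply: eq_bigr => i _.
by rewrite linearZ/= -deriveE// [RHS]mulrC mxE.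
Qed.

Lemma is_derive_comp_grad n (g : 'cV[R]_n -> R) (z : R -> 'cV[R]_n) (t : R)
    (d : 'cV[R]_n) :
  differentiable g (z t) ->
  (forall i, is_derive t 1 (fun u => z u i 0) (d i 0)) ->
  is_derive t 1 (fun u => g (z u)) (dotv (grad g (z t)) d).
Proof.
move=> dg dz.
have dzt : derivable z t 1 by apply/derivable_mxP => i j; rewrite ord1.
have diffz : differentiable z t by apply/derivable1_diffP.
have zd : 'D_1 z t = d.
  by rewrite derive_mx//; apply/matrixP => i j; rewrite mxE ord1 derive_val.
split; first by apply: diff_derivable; exact: differentiable_comp.
rewrite deriveE; last exact: differentiable_comp.
rewrite (diff_comp diffz dg)/= -(deriveE _ diffz) zd.
exact: diff_dotv_grad.
Qed.

Lemma is_derive_quadratic_form n (S : 'M[R]_n) (z : R -> 'cV[R]_n) (t : R)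
    (d : 'cV[R]_n) :
  S^T = S -> (forall i, is_derive t 1 (fun u => z u i 0) (d i 0)) ->
  is_derive t 1 (fun u => dotv (z u) (S *m z u)) (2 * dotv (z t) (S *m d)).
Proof.
move=> symS dz.
(* Written with sums and products of real functions, the form has its derivative computed by the
   [is_derive] instances. *)
have -> : (fun u => dotv (z u) (S *m z u)) =
    \sum_(i < n) ((fun u => z u i 0) * \sum_(j < n) (S i j \*: fun u => z u j 0)).
  apply/funext => u; rewrite dotvE fct_sumE; apply: eq_bigr => i _.
  rewrite mxE [RHS]/GRing.mul/=; congr (_ * _).
  by rewrite fct_sumE.
apply: is_derive_eq.
have -> : 2 * dotv (z t) (S *m d) = dotv (z t) (S *m d) + dotv (S *m z t) d.
  by rewrite dotv_mulmxl symS mulr2n mulrDl !mul1r.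
rewrite !dotvE -big_split/=; apply: eq_bigr => i _.
rewrite !mxE fct_sumE; congr (_ + _).
Qed.

(** Fermat's rule on the line through [z] in direction [i]. It turns the Nash property into
    [pseudograd f xs = 0]. *)
Lemma partial_max_eq0 n (g : 'cV[R]_n -> R) (z : 'cV[R]_n) i :
  C1 g -> (forall a, g (upd z i a) <= g z) -> partial i g z = 0.
Proof.
move=> C1g z_max; pose v : 'cV[R]_n := delta_mx i 0.
pose phi (a : R) := g (a *: v + z).
have phiE a : phi a = g (upd z i (a + z i 0)).
  congr g; apply/matrixP => j k; rewrite ord1 !mxE.
  by case: eqVneq => [->|]; rewrite ?mulr1// mulr0 add0r.
(* The difference quotients of [phi] are directional quotients of [g], so derivability and the value
   of the derivative both transfer. *)
have quot t : (fun h : R => h^-1 *: (phi (h *: 1 + t) - phi t)) =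
    (fun h => h^-1 *: (g (h *: v + (t *: v + z)) - g (t *: v + z))).
  apply/funext => h; rewrite /phi scalerDl addrA; congr (_ *: (g (_ *: _ + _ + _) - _)).
  by rewrite /GRing.scale/= mulr1.
have dphi t : derivable phi t 1.
  by rewrite /derivable /= quot; exact: (C1g i).1.
have : is_derive (0 : R) 1 phi 0.
  apply: (@derive1_at_max _ _ (-1) 1) => //.
  - by rewrite in_itv/= ltrN10 ltr01.
  - by move=> t _; rewrite phiE /phi scale0r add0r.
by case=> _; rewrite /derive quot scale0r add0r.
Qed.

End DerivativeAlongTrajectory.

(** * The Lyapunov function along solutions *)

Section ErrorDynamics.
Context {R : realType} {N : nat}.
Variables (A : 'M[R]_N) (f : 'I_N -> 'cV[R]_N -> R) (kbar : 'I_N -> R).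
Variables (P Q : 'M[R]_(N * N)) (xs : 'cV[R]_N) (Vbar : 'cV[R]_N -> R).

Lemma is_equilibriumP eps tm sm : pseudograd f xs = 0 ->
  is_equilibrium A f kbar eps tm sm xs (ones_tens xs).
Proof.
move=> /matrixP Gxs; split.
- by apply: continuous_subspaceT; exact: cst_continuous.
- by apply: continuous_subspaceT; exact: cst_continuous.
- move=> t i _; rewrite /action_rate estimate_ones_tens.
  by have := Gxs i 0; rewrite !mxE => ->; rewrite mulr0; exact: is_derive_cst.
- move=> m t i j _; rewrite comm_rateE subrr mulmx0 mxE oppr0; exact: is_derive_cst.
- by move=> m t i j _; exact: is_derive_cst.
Qed.

(** The velocity [dy] is left free, so that communication times and silent times ([dy = 0]) are two
    instances. *)
Lemma is_derive_Vfun (x : R -> 'cV[R]_N) (y : R -> 'cV[R]_(N * N)) (t : R)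
    (dx : 'cV[R]_N) (dy : 'cV[R]_(N * N)) :
  P^T = P -> differentiable Vbar (x t - xs) ->
  (forall i, is_derive t 1 (fun u => x u i 0) (dx i 0)) ->
  (forall i j, is_derive t 1 (fun u => ecoord (y u) i j) (ecoord dy i j)) ->
  is_derive t 1 (fun u => Vfun Vbar P (x u - xs) (y u - ones_tens (x u)))
    (dotv (grad Vbar (x t - xs)) dx +
     2 * dotv (y t - ones_tens (x t)) (P *m (dy - ones_tens dx))).
Proof.
move=> symP dVbar x_dx y_dy; apply: is_deriveD.
  apply: (is_derive_comp_grad (z := fun u => x u - xs)) => // i.
  under eq_fun do rewrite !mxE.
  by have := x_dx i => ?; apply: is_derive_eq; rewrite subr0.
apply: (is_derive_quadratic_form (z := fun u => y u - ones_tens (x u))) => // p.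
rewrite -(mxtens_unindexK p); case: (mxtens_unindex p) => i j.
have := y_dy i j => ?; have := x_dx j => ?.
have -> : (fun u => (y u - ones_tens (x u)) (mxtens_index (i, j)) 0) =
    (fun u => ecoord (y u) i j) - (fun u => x u j 0).
  by apply/funext => u; rewrite [LHS]mxE [X in _ + X]mxE ones_tensE.
by apply: is_derive_eq; rewrite [RHS]mxE [X in _ = _ + X]mxE ones_tensE.
Qed.

Lemma continuous_Vfun (x : R -> 'cV[R]_N) (y : R -> 'cV[R]_(N * N)) T :
  {within `[0, T], continuous x} -> {within `[0, T], continuous y} ->
  (forall t, 0 <= t <= T -> differentiable Vbar (x t - xs)) ->
  {within `[0, T], continuous
    (fun t => Vfun Vbar P (x t - xs) (y t - ones_tens (x t)))}.
Proof.
move=> /subspace_continuousP x_cont /subspace_continuousP y_cont dV.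
apply/subspace_continuousP => t tT; apply: cvgD.
  apply: (@cvg_comp _ _ _ (fun s => x s - xs) Vbar _ (nbhs (x t - xs))).
    by apply: cvgB; [exact: x_cont|exact: cvg_cst].
  have /dV dVt : 0 <= t <= T by move: tT; rewrite /= in_itv.
  exact: (differentiable_continuous dVt).
have coord_cvg n (z : R -> 'cV[R]_n) i : z s @[s --> within `[0, T] (nbhs t)] --> z t ->
    z s i 0 @[s --> within `[0, T] (nbhs t)] --> z t i 0.
  move=> zt; apply: (@cvg_comp _ _ _ z (fun M => M i 0) _ _ _ zt).
  exact: coord_continuous.
have ex_cvg p : (y s - ones_tens (x s)) p 0 @[s --> within `[0, T] (nbhs t)]
    --> (y t - ones_tens (x t)) p 0.
  rewrite !mxE; under eq_fun do rewrite !mxE.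
  by apply: cvgB; apply: coord_cvg; [exact: y_cont|exact: x_cont].
exact: cvg_bilinear_form.
Qed.

End ErrorDynamics.

(** * Comparison of the state error with the pair of errors *)

Section ErrorNorms.
Context {R : realType} {N : nat}.
Implicit Types (x : 'cV[R]_N) (y : 'cV[R]_(N * N)).

Lemma enorm_col_mx n m (u : 'cV[R]_n) (v : 'cV[R]_m) :
  enorm (col_mx u v) ^+ 2 = enorm u ^+ 2 + enorm v ^+ 2.
Proof.
rewrite !enorm_sum big_split_ord/=; congr (_ + _); apply: eq_bigr => i _.
  by rewrite col_mxEu.
by rewrite col_mxEd.
Qed.

Lemma sqr_enormD_le n (u v : 'cV[R]_n) :
  enorm (u + v) ^+ 2 <= 2 * enorm u ^+ 2 + 2 * enorm v ^+ 2.
Proof.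
rewrite (@le_trans _ _ ((enorm u + enorm v) ^+ 2))//.
  by rewrite ler_sqr ?nnegrE ?addr_ge0 ?enorm_ge0// ler_enormD.
by have := sqr_ge0 (enorm u - enorm v); nra.
Qed.

Lemma sqr_enorm_ones_tens x : enorm (ones_tens x) ^+ 2 = N%:R * enorm x ^+ 2.
Proof. by rewrite enorm_ones_tens exprMn (@sqr_sqrtr _ N%:R). Qed.

Let N_ge0 : 0 <= N%:R :> R. Proof. exact: ler0n. Qed.

(** The state error in [y] is [ex + ones_tens e], and [ones_tens] multiplies squared norms by [N];
    the inequality for the square of a sum then costs [2 (N + 1)]. The converse comparison below has
    the same constant. *)
Lemma sqr_enorm_state_le xs x y :
  enorm (col_mx x y - col_mx xs (ones_tens xs)) ^+ 2 <=
    2 * N.+1%:R * (enorm (x - xs) ^+ 2 + enorm (y - ones_tens x) ^+ 2).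
Proof.
rewrite opp_col_mx add_col_mx enorm_col_mx.
have -> : y - ones_tens xs = (y - ones_tens x) + ones_tens (x - xs).
  by rewrite ones_tensD ones_tensN addrA subrK.
have := sqr_enormD_le (y - ones_tens x) (ones_tens (x - xs)).
rewrite sqr_enorm_ones_tens -natr1.
have := sqr_ge0 (enorm (x - xs)); have := sqr_ge0 (enorm (y - ones_tens x)).
move: N_ge0; nra.
Qed.

Lemma sqr_enorm_error_le xs x y :
  enorm (x - xs) ^+ 2 + enorm (y - ones_tens x) ^+ 2 <=
    2 * N.+1%:R * enorm (col_mx x y - col_mx xs (ones_tens xs)) ^+ 2.
Proof.
rewrite opp_col_mx add_col_mx enorm_col_mx.
have -> : y - ones_tens x = (y - ones_tens xs) + - ones_tens (x - xs).
  by rewrite ones_tensD ones_tensN opprD opprK addrACA addNr addr0.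
have := sqr_enormD_le (y - ones_tens xs) (- ones_tens (x - xs)).
rewrite enormN sqr_enorm_ones_tens -natr1.
have := sqr_ge0 (enorm (x - xs)); have := sqr_ge0 (enorm (y - ones_tens xs)).
move: N_ge0; nra.
Qed.

End ErrorNorms.

(** * Rates of the Lyapunov function in the two regimes *)

Section LyapunovRates.
Context {R : realType} {N : nat}.
Variables (A : 'M[R]_N) (P Q : 'M[R]_(N * N)).
Hypotheses (N_gt0 : (0 < N)%N) (P_pos : posdefmx P) (Q_pos : posdefmx Q).
Hypothesis PQ : (LBmx A)^T *m P + P *m LBmx A = Q.
Variables (f : 'I_N -> 'cV[R]_N -> R) (alpha : R).
Hypotheses (alpha_gt0 : 0 < alpha) (f_lip : lipschitz_partials f alpha).
Variables (xs : 'cV[R]_N) (kbar : 'I_N -> R).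
Hypotheses (Gxs : pseudograd f xs = 0) (kbar_gt0 : forall i, 0 < kbar i).
Variables (Vbar : 'cV[R]_N -> R) (gamma1 gamma2 gamma3 gamma4 gamma5 : R).
Hypothesis gamma3_gt0 : 0 < gamma3.
Hypothesis Vbar_bounds :
  lyapunov_bounds f kbar xs Vbar gamma1 gamma2 gamma3 gamma4 gamma5.
Variables (eta1 eta2 : R).
Hypotheses (eta1_gt0 : 0 < eta1) (eta2_gt0 : 0 < eta2).
Hypothesis V_bounds : forall (e : 'cV[R]_N) (ex : 'cV[R]_(N * N)),
  enorm e <= gamma5 ->
  eta1 * (enorm e ^+ 2 + enorm ex ^+ 2) <= Vfun Vbar P e ex
    <= eta2 * (enorm e ^+ 2 + enorm ex ^+ 2).

Let p1 := pi1 kbar P alpha gamma4.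
Let p2 := pi2 kbar P alpha.
Let lQ := lambda_min Q.

(** The determinant of [Gamma1] is [eps (gamma3 lQ - eps (gamma3 p2 + p1^2))]; its positivity is the
    origin of the first term in [eps_star]. *)
Lemma lambda_min_Gamma1_gt0 eps :
  0 < eps -> eps * (gamma3 * p2 + p1 ^+ 2) < gamma3 * lQ ->
  0 < lambda_min (Gamma1 gamma3 lQ p1 p2 eps).
Proof.
move=> eps0 lt_eps; apply: lambda_min_mx22_gt0; first exact: mulr_gt0.
rewrite sqrrN -subr_gt0.
have -> : eps * gamma3 * (lQ - eps * p2) - (eps * p1) ^+ 2 =
  eps * (gamma3 * lQ - eps * (gamma3 * p2 + p1 ^+ 2)) by ring.
by rewrite mulr_gt0// subr_gt0.
Qed.

Lemma lambda_max_Gamma2_gt0 eps :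
  0 < eps -> 0 < lambda_max (Gamma2 gamma3 p1 p2 eps).
Proof.
move=> eps0; have := lambda_max_mx22_ge (Num.sqrt eps * gamma3) (eps * p1) (eps * p2) 1 0.
rewrite expr1n expr0n/= !mulr0 !mulr1 !addr0 mulr1; apply: lt_le_trans.
by rewrite mulr_gt0// sqrtr_gt0.
Qed.

Lemma Vdot_comm_le eps x y (dy : 'cV[R]_(N * N)) : 0 < eps ->
  0 < lambda_min (Gamma1 gamma3 lQ p1 p2 eps) ->
  enorm (x - xs) < gamma5 ->
  (forall i j, ecoord dy i j = comm_rate A x y i j) ->
  dotv (grad Vbar (x - xs)) (\col_i action_rate f kbar eps y i) +
    2 * dotv (y - ones_tens x)
      (P *m (dy - ones_tens (\col_i action_rate f kbar eps y i))) <=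
  - (lambda_min (Gamma1 gamma3 lQ p1 p2 eps) / eta2) *
    Vfun Vbar P (x - xs) (y - ones_tens x).
Proof.
move=> eps0 mu_gt0 e_lt dyE.
have [_ gK g_le] := Vbar_bounds.2 _ e_lt; rewrite subrK in gK.
have [ex exE] : exists ex, ex = y - ones_tens x by eexists.
have [v vE] : exists v, v = \col_i action_rate f kbar eps y i by eexists.
have drift := action_drift_le P alpha_gt0 f_lip kbar_gt0 eps0 Gxs gK g_le exE vE.
have /andP[_ V_le] := V_bounds ex (ltW e_lt).
rewrite -exE -vE.
have -> : dy = - (LBmx A *m ex).
  apply/matrixP => p k; rewrite ord1 -(mxtens_unindexK p).
  case: (mxtens_unindex p) => i j; have := dyE i j; rewrite /ecoord => ->.
  by rewrite comm_rateE -exE [RHS]mxE.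
rewrite mulmxDr dotvDr mulrDr (lyapunov_form _ P_pos.1 PQ) mulmxN dotvNr.
have NN : (0 < N * N)%N by rewrite muln_gt0 N_gt0.
have Q_ge := (lambda_minP Q_pos.1 NN).2 ex.
have := lambda_min_mx22_le (eps * gamma3) (- (eps * p1)) (lQ - eps * p2)
  (enorm (x - xs)) (enorm ex).
rewrite -/(Gamma1 gamma3 lQ p1 p2 eps).
move: mu_gt0; move: (lambda_min (Gamma1 _ _ _ _ _)) => l mu_gt0 form.
(* Drift and dissipation together are minus the form of [Gamma1]. As [l] is positive, the upper
   bound of V by [eta2] converts squared norms into V. *)
apply: (@le_trans _ _ (- l * (enorm (x - xs) ^+ 2 + enorm ex ^+ 2))).
  by move: drift Q_ge form; rewrite -/p1 -/p2 -/lQ; lra.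
rewrite !mulNr lerN2 -mulrA ler_wpM2l ?(ltW mu_gt0)//.
by rewrite ler_pdivrMl.
Qed.

Lemma Vdot_silent_le eps x y : 0 < eps ->
  enorm (x - xs) < gamma5 ->
  dotv (grad Vbar (x - xs)) (\col_i action_rate f kbar eps y i) +
    2 * dotv (y - ones_tens x)
      (P *m (0 - ones_tens (\col_i action_rate f kbar eps y i))) <=
  lambda_max (Gamma2 gamma3 p1 p2 eps) / eta1 *
    Vfun Vbar P (x - xs) (y - ones_tens x).
Proof.
move=> eps0 e_lt.
have [_ gK g_le] := Vbar_bounds.2 _ e_lt; rewrite subrK in gK.
have [ex exE] : exists ex, ex = y - ones_tens x by eexists.
have [v vE] : exists v, v = \col_i action_rate f kbar eps y i by eexists.
have drift := action_drift_le P alpha_gt0 f_lip kbar_gt0 eps0 Gxs gK g_le exE vE.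
have /andP[V_ge _] := V_bounds ex (ltW e_lt).
rewrite -exE -vE sub0r mulmxN dotvNr mulrN (le_trans drift)//.
have := lambda_max_mx22_ge (Num.sqrt eps * gamma3) (eps * p1) (eps * p2)
  (enorm (x - xs)) (enorm ex).
have := lambda_max_Gamma2_gt0 eps0; rewrite -/(Gamma2 gamma3 p1 p2 eps).
move: (lambda_max _) => l l_gt0 form.
apply: (@le_trans _ _ (l * (enorm (x - xs) ^+ 2 + enorm ex ^+ 2))); last first.
  by rewrite -mulrA ler_wpM2l ?(ltW l_gt0)// ler_pdivlMl.
(* The drift and [Gamma2] differ only in the coefficient of [|e|^2]: the negative [- eps * gamma3]
   is relaxed to the positive [Num.sqrt eps * gamma3]. *)
apply: le_trans form; rewrite -/p1 -/p2 !lerD2r ler_wpM2r ?sqr_ge0//.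
have eg : 0 < eps * gamma3 by rewrite mulr_gt0.
have sg : 0 < Num.sqrt eps * gamma3 by rewrite mulr_gt0 ?sqrtr_gt0.
lra.
Qed.

End LyapunovRates.

(** * From the rates to exponential stability *)

Section Stability.
Context {R : realType} {N : nat}.
Variables (A : 'M[R]_N) (P : 'M[R]_(N * N)) (f : 'I_N -> 'cV[R]_N -> R).
Variables (kbar : 'I_N -> R) (eps : R) (tm sm : nat -> R) (theta T0 : R).
Hypotheses (symP : P^T = P) (tm_sm : schedule tm sm) (T0_ge0 : 0 <= T0).
Hypothesis acr : admits_ACR tm sm theta T0.
Variables (xs : 'cV[R]_N) (Vbar : 'cV[R]_N -> R) (gamma5 eta1 eta2 mu1 mu2 : R).
Hypotheses (gamma5_gt0 : 0 < gamma5) (eta1_gt0 : 0 < eta1) (eta2_gt0 : 0 < eta2).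
Hypotheses (mu1_gt0 : 0 < mu1) (mu2_gt0 : 0 < mu2).
Hypothesis Vbar_diff : forall e : 'cV[R]_N, enorm e < gamma5 -> differentiable Vbar e.
Hypothesis V_bounds : forall (e : 'cV[R]_N) (ex : 'cV[R]_(N * N)),
  enorm e <= gamma5 ->
  eta1 * (enorm e ^+ 2 + enorm ex ^+ 2) <= Vfun Vbar P e ex
    <= eta2 * (enorm e ^+ 2 + enorm ex ^+ 2).

Let Vdot (x : 'cV[R]_N) (y dy : 'cV[R]_(N * N)) :=
  dotv (grad Vbar (x - xs)) (\col_i action_rate f kbar eps y i) +
  2 * dotv (y - ones_tens x)
    (P *m (dy - ones_tens (\col_i action_rate f kbar eps y i))).

Hypothesis Vdot_comm : forall x y dy, enorm (x - xs) < gamma5 ->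
  (forall i j, ecoord dy i j = comm_rate A x y i j) ->
  Vdot x y dy <= - mu1 * Vfun Vbar P (x - xs) (y - ones_tens x).
Hypothesis Vdot_silent : forall x y, enorm (x - xs) < gamma5 ->
  Vdot x y 0 <= mu2 * Vfun Vbar P (x - xs) (y - ones_tens x).
Hypothesis theta_gt : mu2 / (mu1 + mu2) < theta.

Let rate := mu1 * theta - mu2 * (1 - theta).
Let overshoot := (mu1 + mu2) * T0.

Let rate_gt0 : 0 < rate.
Proof.
move: theta_gt; rewrite (ltr_pdivrMr _ _ (addr_gt0 mu1_gt0 mu2_gt0)) /rate => h.
by rewrite subr_gt0; lra.
Qed.

Lemma ACR_exponent_le T : 0 <= T ->
  - mu1 * comm_length tm sm T 0 + mu2 * silent_length tm sm T 0 <=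
    overshoot - rate * T.
Proof.
rewrite le_eqVlt => /predU1P[<-|T_gt0].
  (* The ratio is postulated for [s < t], so [T = 0] is treated apart, with an empty interval. *)
  rewrite /silent_length (_ : comm_length tm sm 0 0 = 0).
    by rewrite !subr0 !mulr0 addr0 subr0 mulr_ge0// ltW// addr_gt0.
  have [tm0 /(_ 0%N)[lt0 _] _] := tm_sm.
  by rewrite (comm_length_comm (m := 0%N)) ?subrr// ?tm0 ?lexx//= -tm0 ltW.
have [_ /(_ 0 T (lexx _) T_gt0)[M_ge Mc_le]] := acr.
have := ler_wpM2l (ltW mu1_gt0) M_ge; have := ler_wpM2l (ltW mu2_gt0) Mc_le.
by rewrite /overshoot /rate subr0; lra.
Qed.

(** The bound on [e] includes the time [T] because continuity of V up to [T] rests on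
    differentiability of [Vbar] there. *)
Lemma V_decay x y T : is_solution A f kbar eps tm sm x y -> 0 <= T ->
  (forall t, 0 <= t <= T -> enorm (x t - xs) < gamma5) ->
  Vfun Vbar P (x T - xs) (y T - ones_tens (x T)) <=
    Vfun Vbar P (x 0 - xs) (y 0 - ones_tens (x 0)) *
      expR (overshoot - rate * T).
Proof.
move=> [x_cont y_cont dx dy_comm dy_silent] T_ge0 e_lt.
have seg n (z : R -> 'cV[R]_n) : {within [set` `[0, +oo[], continuous z} ->
    {within `[0, T], continuous z}.
  by apply: continuous_subspaceW => t /=; rewrite !in_itv/= => /andP[->].
pose V t := Vfun Vbar P (x t - xs) (y t - ones_tens (x t)).
have V0_ge0 : 0 <= V 0.
  have e0 : enorm (x 0 - xs) <= gamma5 by rewrite ltW// e_lt// lexx.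
  have /andP[+ _] := V_bounds (y 0 - ones_tens (x 0)) e0.
  by apply: le_trans; rewrite mulr_ge0 ?(ltW eta1_gt0)// addr_ge0// sqr_ge0.
have dV (s : R) (dy : 'cV[R]_(N * N)) : 0 < s < T ->
    (forall i j, is_derive s 1 (fun u => ecoord (y u) i j) (ecoord dy i j)) ->
    is_derive s 1 V (Vdot (x s) (y s) dy).
  move=> /andP[t0 tT] y_dy; apply: is_derive_Vfun => // [|i].
    by apply: Vbar_diff; apply: e_lt; rewrite !ltW.
  by rewrite mxE; exact: dx.
apply: (@le_trans _ _ (V 0 * expR (- mu1 * comm_length tm sm T 0 +
                                   mu2 * silent_length tm sm T 0))); last first.
  by rewrite ler_wpM2l// ler_expR ACR_exponent_le.
apply: (intermittent_decay tm_sm (v := V) T_ge0).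
- apply: continuous_Vfun => [||t t_T]; [exact: seg|exact: seg|].
  exact/Vbar_diff/e_lt.
- move=> m t tT /andP[mt tsm].
  have t0 : 0 < t by rewrite (le_lt_trans (schedule_tm_ge0 tm_sm m)).
  pose dy : 'cV[R]_(N * N) :=
    \col_p comm_rate A (x t) (y t) (mxtens_unindex p).1 (mxtens_unindex p).2.
  have dyE i j : ecoord dy i j = comm_rate A (x t) (y t) i j.
    by rewrite /ecoord mxE mxtens_indexK.
  exists (Vdot (x t) (y t) dy); last by apply: Vdot_comm => //; apply: e_lt; rewrite !ltW.
  apply: dV => [|i j]; first by rewrite t0.
  by rewrite dyE; apply: (dy_comm m); rewrite mt.
- move=> m t tT /andP[smt ttm].
  have t0 : 0 < t.
    have [_ /(_ m)[lt_ts _] _] := tm_sm.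
    by rewrite (le_lt_trans (schedule_tm_ge0 tm_sm m))// (lt_trans lt_ts).
  exists (Vdot (x t) (y t) 0); last by apply: Vdot_silent => //; apply: e_lt; rewrite !ltW.
  apply: dV => [|i j]; first by rewrite t0.
  by rewrite {2}/ecoord mxE; apply: (dy_silent m); rewrite smt.
Qed.

Lemma exponentially_stable_equilibrium :
  exponentially_stable A f kbar eps tm sm xs (ones_tens xs).
Proof.
pose k : R := 2 * N.+1%:R.
have k_gt0 : 0 < k by rewrite mulr_gt0.
(* One factor [k] for each direction of the comparison of errors, [eta2 / eta1] for the passage
   through V, and the overshoot caused by [T0]. All this concerns squared norms, hence the square
   root in [c] and the halved rate. *)
pose c2 := k ^+ 2 * (eta2 / eta1) * expR overshoot.
have c2_gt0 : 0 < c2 by rewrite !mulr_gt0 ?expR_gt0 ?invr_gt0 ?exprn_gt0.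
pose c := Num.sqrt c2.
have c_gt0 : 0 < c by rewrite sqrtr_gt0.
(* The first bound starts the trajectory inside the half ball; the second makes [c * enorm (z 0)]
   smaller than its radius. *)
exists (Num.min (gamma5 / 2) (gamma5 / 2 / c)), c, (rate / 2); split=> //.
- by rewrite lt_min !divr_gt0.
- by rewrite divr_gt0.
move=> x y xy_sol; rewrite lt_min => /andP[z0_lt z0_lt_c].
pose z t := col_mx (x t) (y t) - col_mx xs (ones_tens xs).
have e_le_z t : enorm (x t - xs) <= enorm (z t).
  rewrite -ler_sqr ?nnegrE ?enorm_ge0// /z opp_col_mx add_col_mx enorm_col_mx.
  by rewrite lerDl sqr_ge0.
have z_le T : 0 <= T -> (forall t, 0 <= t <= T -> enorm (x t - xs) < gamma5) ->
    enorm (z T) <= c * enorm (z 0) * expR (- (rate / 2) * T).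
  move=> T_ge0 e_lt.
  rewrite -ler_sqr ?nnegrE ?mulr_ge0 ?enorm_ge0 ?expR_ge0 ?(ltW c_gt0)//.
  rewrite !exprMn (sqr_sqrtr (ltW c2_gt0)) -expRM_natl.
  rewrite (_ : 2%:R * _ = - rate * T); last by field.
  have V_T := V_decay xy_sol T_ge0 e_lt.
  have T_in : 0 <= T <= T by rewrite T_ge0 lexx.
  have O_in : 0 <= (0 : R) <= T by rewrite lexx.
  have /andP[VT_ge _] := V_bounds (y T - ones_tens (x T)) (ltW (e_lt T T_in)).
  have /andP[_ V0_le] := V_bounds (y 0 - ones_tens (x 0)) (ltW (e_lt 0 O_in)).
  apply: le_trans (sqr_enorm_state_le _ _ _) _; rewrite -/k.
  have r_T := le_trans (le_trans VT_ge V_T) (ler_wpM2r (expR_ge0 _) V0_le).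
  have {}r_T : enorm (x T - xs) ^+ 2 + enorm (y T - ones_tens (x T)) ^+ 2 <=
      eta2 / eta1 * expR overshoot * expR (- rate * T) *
      (enorm (x 0 - xs) ^+ 2 + enorm (y 0 - ones_tens (x 0)) ^+ 2).
    rewrite -(ler_pM2l eta1_gt0) (le_trans r_T)// expRD mulNr.
    by rewrite le_eqVlt; apply/orP; left; apply/eqP; field; rewrite gt_eqF.
  rewrite -(ler_pM2l k_gt0) in r_T; apply: le_trans r_T _.
  have r0 := sqr_enorm_error_le xs (x 0) (y 0); rewrite -/k -/(z 0) in r0.
  have w_ge0 : 0 <= k * (eta2 / eta1 * expR overshoot * expR (- rate * T)).
    by rewrite !mulr_ge0 ?expR_ge0 ?invr_ge0 ?ltW.
  rewrite [X in X <= _]mulrA; apply: le_trans (ler_wpM2l w_ge0 r0) _.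
  by rewrite le_eqVlt; apply/orP; left; apply/eqP; rewrite /c2; field; rewrite gt_eqF.
have e_lt : forall t, 0 <= t -> enorm (x t - xs) < gamma5 / 2.
  apply: lt_of_no_first_exit.
  - have [x_cont _ _ _ _] := xy_sol.
    move/subspace_continuousP: x_cont => x_cont; apply/subspace_continuousP => t t_ge0.
    apply: cvg_enorm => i; rewrite !mxE; under eq_fun do rewrite !mxE.
    apply: cvgB; last exact: cvg_cst.
    apply: (@cvg_comp _ _ _ x (fun M => M i 0)); first exact: x_cont.
    exact: coord_continuous.
  - exact: le_lt_trans (e_le_z 0) z0_lt.
  - move=> t t_ge0 e_le; apply: le_lt_trans (e_le_z t) _.
    (* Up to the exit time only [<= gamma5 / 2] is known; the halved radius makes this strictly less
       than [gamma5], as [z_le] demands. *)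
    have t_lt s : 0 <= s <= t -> enorm (x s - xs) < gamma5.
      by move=> /e_le/le_lt_trans; apply; rewrite ltr_pdivrMr// mulr_natr mulr2n ltrDl.
    apply: le_lt_trans (z_le t t_ge0 t_lt) _.
    apply: (@le_lt_trans _ _ (c * enorm (z 0))).
      rewrite ler_piMr ?mulr_ge0 ?enorm_ge0 ?(ltW c_gt0)// -expR0 ler_expR.
      by rewrite mulNr oppr_le0 mulr_ge0// divr_ge0// ltW.
    by rewrite mulrC -ltr_pdivlMr.
move=> t t_ge0; apply: z_le => // s /andP[s_ge0 _].
by rewrite (lt_trans (e_lt s s_ge0))// ltr_pdivrMr// mulr_natr mulr2n ltrDl.
Qed.

End Stability.

(** * Choice of [eps] and conclusion *)

Lemma posdefmx_neq0 (R : realType) n (S : 'M[R]_n) :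
  (0 < n)%N -> posdefmx S -> S != 0.
Proof.
move=> n_gt0 [_ S_gt0]; apply/eqP => S0.
have /S_gt0 : (const_mx 1 : 'cV[R]_n) != 0.
  apply/eqP => /matrixP/(_ (Ordinal n_gt0) 0); rewrite !mxE => /eqP.
  by rewrite oner_eq0.
by rewrite S0 mul0mx dotv0 ltxx.
Qed.

Theorem theorem3 (R : realType) (N : nat) (N_gt0 : (0 < N)%N)
  (E : rel 'I_N) (A : 'M[R]_N)
  (E_irrefl : irreflexive E)
  (A_adj : weighted_adjacency E A)
  (E_conn : strongly_connected E)
  (P Q : 'M[R]_(N * N))
  (P_diag : is_diag_mx P) (P_pos : posdefmx P) (Q_pos : posdefmx Q)
  (PQ : (LBmx A)^T *m P + P *m LBmx A = Q)
  (f : 'I_N -> 'cV[R]_N -> R)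
  (f_C2 : forall i, C2 (f i))
  (alpha : R) (alpha_gt0 : 0 < alpha) (f_lip : lipschitz_partials f alpha)
  (f_concave : concave_own f)
  (beta : R) (beta_gt0 : 0 < beta) (f_mono : strongly_monotone f beta)
  (xs : 'cV[R]_N) (xs_nash : is_nash f xs)
  (kbar : 'I_N -> R) (kbar_gt0 : forall i, 0 < kbar i)
  (Vbar : 'cV[R]_N -> R) (gamma1 gamma2 gamma3 gamma4 gamma5 : R)
  (gamma1_gt0 : 0 < gamma1) (gamma2_gt0 : 0 < gamma2) (gamma3_gt0 : 0 < gamma3)
  (gamma4_gt0 : 0 < gamma4) (gamma5_gt0 : 0 < gamma5)
  (Vbar_bounds :
     lyapunov_bounds f kbar xs Vbar gamma1 gamma2 gamma3 gamma4 gamma5)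
  (eta1 eta2 : R) (eta1_gt0 : 0 < eta1) (eta2_gt0 : 0 < eta2)
  (V_bounds : forall (e : 'cV[R]_N) (ex : 'cV[R]_(N * N)), enorm e <= gamma5 ->
     eta1 * (enorm e ^+ 2 + enorm ex ^+ 2) <= Vfun Vbar P e ex
       <= eta2 * (enorm e ^+ 2 + enorm ex ^+ 2)) :
  let p1 := pi1 kbar P alpha gamma4 in
  let p2 := pi2 kbar P alpha in
  let lQ := lambda_min Q in
  let mu1 := fun eps => lambda_min (Gamma1 gamma3 lQ p1 p2 eps) / eta2 in
  let mu2 := fun eps => lambda_max (Gamma2 gamma3 p1 p2 eps) / eta1 in
  exists eps : R,
    0 < eps < eps_star gamma3 lQ p1 p2 /\
    forall (tm sm : nat -> R) (theta T0 : R),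
      schedule tm sm ->
      0 <= T0 -> admits_ACR tm sm theta T0 ->
      mu2 eps / (mu1 eps + mu2 eps) < theta ->
      is_equilibrium A f kbar eps tm sm xs (ones_tens xs) /\
      exponentially_stable A f kbar eps tm sm xs (ones_tens xs).
Proof.
move=> p1 p2 lQ mu1 mu2.
have NN : (0 < N * N)%N by rewrite muln_gt0 N_gt0.
have kmax_gt0 : 0 < kmax kbar.
  exact: lt_le_trans (kbar_gt0 (Ordinal N_gt0)) (kmax_ge _ _).
have P_gt0 : 0 < opnorm P := opnorm_gt0 (posdefmx_neq0 NN P_pos).
have p1_gt0 : 0 < p1 by rewrite /p1 /pi1 !mulr_gt0// addr_gt0 ?divr_gt0 ?mulr_gt0 ?ltr0n.
have p2_gt0 : 0 < p2 by rewrite /p2 /pi2 !mulr_gt0 ?sqrtr_gt0 ?ltr0n.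
have lQ_gt0 : 0 < lQ := lambda_min_gt0 Q_pos NN.
have den_gt0 : 0 < gamma3 * p2 + p1 ^+ 2.
  exact: addr_gt0 (mulr_gt0 gamma3_gt0 p2_gt0) (exprn_gt0 2 p1_gt0).
have eps_star_gt0 : 0 < eps_star gamma3 lQ p1 p2.
  by rewrite lt_min (divr_gt0 (mulr_gt0 _ lQ_gt0))// divr_gt0 ?exprn_gt0// mulr_gt0 ?exprn_gt0.
(* The witness precedes the schedule, [theta] and [T0], so it depends on the graph and game data
   alone. *)
exists (eps_star gamma3 lQ p1 p2 / 2); set eps := _ / 2.
have eps_gt0 : 0 < eps by rewrite divr_gt0.
have eps_lt : eps < eps_star gamma3 lQ p1 p2.
  by rewrite ltr_pdivrMr// mulr_natr mulr2n ltrDl.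
split=> [|tm sm theta T0 tm_sm T0_ge0 acr theta_gt]; first by rewrite eps_gt0.
have Gxs : pseudograd f xs = 0.
  apply/matrixP => i j; rewrite !mxE; apply: partial_max_eq0; first exact: (f_C2 i).1.
  exact: xs_nash.
split; first exact: is_equilibriumP.
have Gamma1_gt0 : 0 < lambda_min (Gamma1 gamma3 lQ p1 p2 eps).
  (* Being below the first term of the minimum is the determinant condition on [Gamma1]. *)
  apply: lambda_min_Gamma1_gt0 => //; rewrite -ltr_pdivlMr//.
  by apply: lt_le_trans eps_lt _; rewrite ge_min lexx.
have Gamma2_gt0 : 0 < lambda_max (Gamma2 gamma3 p1 p2 eps).
  exact: lambda_max_Gamma2_gt0.
apply: (@exponentially_stable_equilibrium R N A P f kbar eps tm sm theta T0 _ _ _ _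
  xs Vbar gamma5 eta1 eta2 (mu1 eps) (mu2 eps)) => //.
- exact: P_pos.1.
- exact: divr_gt0.
- exact: divr_gt0.
- by move=> e /Vbar_bounds.2[].
- move=> x y dy e_lt dyE.
  exact: (Vdot_comm_le N_gt0 P_pos Q_pos PQ alpha_gt0 f_lip Gxs kbar_gt0
    Vbar_bounds eta2_gt0 V_bounds eps_gt0 Gamma1_gt0 e_lt dyE).
- move=> x y e_lt.
  exact: (Vdot_silent_le alpha_gt0 f_lip Gxs kbar_gt0 gamma3_gt0
    Vbar_bounds eta1_gt0 V_bounds y eps_gt0 e_lt).
Qed.
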